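(* Let $\{\theta_k\}$ be generated by the $Q$-learning with linear function approximation algorithm $$\theta_{k+1}=\theta_k+\alpha_k\phi(S_k,A_k)\Delta(\theta_k,S_k,A_k,S_{k+1}),\qquad \theta_0\in\mathbb{R}^d,$$ where $\Delta(\theta,s,a,s')=\mathcal{R}(s,a)+\gamma\max_{a'\in\mathcal{A}}\phi(s',a')^\top\theta-\phi(s,a)^\top\theta$. Suppose that the assumptions (Q1) and (Q2) in the context are satisfied. Let $M=1+\gamma+r_{\max}$, $\eta_1=(\|\theta_0\|+\|\theta_0-\theta^*\|+1)^2$, $\eta_2=130M^2(\|\theta^*\|+1)^2$, and $M_1=\frac{\log(C'/\rho')}{\log(1/\rho')}$. Then: (1) When $\alpha_k\equiv\alpha$ with $\alpha\in(0,1)$ chosen such that $\alpha t_\alpha\le\frac{\kappa}{260M^2}$, for all $k\ge t_\alpha$: $$\mathbb{E}[\|\theta_k-\theta^*\|^2]\le\eta_1(1-\kappa\alpha/2)^{k-t_\alpha}+2\eta_2\alpha t_\alpha/\kappa.$$ (2) When $\alpha_k=\alpha/(k+h)$, where $\alpha>2/\kappa$ and $h$ is large enough (i.e. for all $h\ge\bar h$ for some $\bar h>0$), there exists $K'>0$ such that for all $k\ge K'$: $$\mathbb{E}[\|\theta_k-\theta^*\|^2]\le\eta_1\left(\frac{K'+h}{k+h}\right)^{\frac{\kappa\alpha}{2}}+\frac{16e\,\eta_2\alpha^2M_1}{\kappa\alpha-2}\,\frac{\log\left(\frac{k+h}{\alpha}\right)+1}{k+h}.$$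
   Context: $\|\cdot\|$ is the Euclidean norm; $\|\cdot\|_{\mathrm{TV}}$ is total variation distance ($\sup_A|\mu(A)-\nu(A)|$). Consider a Markov decision process with finite state space $\mathcal{S}$ ($|\mathcal{S}|=n$), finite action space $\mathcal{A}$ ($|\mathcal{A}|=m$), action-dependent transition matrices $P_a\in\mathbb{R}^{n\times n}$ ($a\in\mathcal{A}$), reward function $\mathcal{R}:\mathcal{S}\times\mathcal{A}\to[0,r_{\max}]$, and discount factor $\gamma\in(0,1)$. Let $\phi_1,\dots,\phi_d\in\mathbb{R}^{mn}$ be linearly independent basis vectors (indexed by state-action pairs), $\phi(s,a)=[\phi_1(s,a),\dots,\phi_d(s,a)]^\top$, normalized so that $\|\phi(s,a)\|\le1$ for all $(s,a)$, and $\tilde Q_\theta(s,a)=\phi(s,a)^\top\theta$. $\{(S_k,A_k)\}$ is a trajectory generated by a behavior policy $\pi$: $A_k\sim\pi(\cdot|S_k)$, $S_{k+1}\sim P_{A_k}(S_k,\cdot)$. (Q1) $\pi(a|s)>0$ for all $(s,a)$, and the Markov chain $\{S_k\}$ induced by $\pi$ is irreducible and aperiodic. Consequently it has a unique stationary distribution $\mu_S$, and $C'\ge1$, $\rho'\in(0,1)$ denote constants with $\max_{s\in\mathcal{S}}\|P^k(s,\cdot)-\mu_S(\cdot)\|_{\mathrm{TV}}\le C'\rho'^k$ for all $k\ge0$, where $P$ is the transition matrix of $\{S_k\}$. (Q2) The equation $\mathbb{E}_{S\sim\mu_S,A\sim\pi(\cdot|S),S'\sim P_A(S,\cdot)}[\phi(S,A)\Delta(\theta,S,A,S')]=0$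 in $\theta$ has a unique solution $\theta^*$, and there is $\kappa>0$ such that for all $\theta\in\mathbb{R}^d$, $\gamma^2\,\mathbb{E}_{S\sim\mu_S}[\max_{a\in\mathcal{A}}\tilde Q_\theta(S,a)^2]-\mathbb{E}_{S\sim\mu_S,A\sim\pi(\cdot|S)}[\tilde Q_\theta(S,A)^2]\le-\kappa\|\theta\|^2$. Let $X_k=(S_k,A_k,S_{k+1})$, a Markov chain on $\mathcal{X}=\{(s,a,s'):s\in\mathcal{S},\pi(a|s)>0,P_a(s,s')>0\}$ with stationary distribution $\mu_X(s,a,s')=\mu_S(s)\pi(a|s)P_a(s,s')$. For $\delta>0$, $t_\delta=\min\{k\ge0:\max_{x\in\mathcal{X}}\|P_X^k(x,\cdot)-\mu_X(\cdot)\|_{\mathrm{TV}}\le\delta\}$ is its mixing time, $P_X$ being the transition matrix of $\{X_k\}$.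
   Formalization: Part (1) additionally assumes that α < 1/2 whenever t_α = 0 (the claim as stated fails for t_α = 0 with α ≥ 1/2, e.g. one state, two equiprobable actions with different rewards and equal features); the number of basis vectors d is at least 1. *)

(* Defs.v *)
From HB Require Import structures.
From mathcomp Require Import all_boot all_order all_algebra.
From mathcomp Require Import all_classical all_reals all_analysis.
Set Implicit Arguments.
Unset Strict Implicit.
Unset Printing Implicit Defensive.
Import Order.TTheory GRing.Theory Num.Theory.
Import numFieldNormedType.Exports.
Local Open Scope classical_set_scope.
Local Open Scope ring_scope.

(* The maximum of a real function over a nonempty finite type; there is no
   neutral element for max on R, so the fold is seeded with a value of F. *)
Definition fmax (R : realType) (T : finType) (F : T -> R) : R :=
  if [pick x : T] is Some x0 then \big[Num.max/F x0]_(x : T) F x else 0.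

(* The norm `|x| of MathComp-Analysis on matrices is the sup norm. *)
Definition l2norm (R : realType) (d : nat) (x : 'cV[R]_d) : R :=
  Num.sqrt (\sum_(i < d) x i 0 ^+ 2).

Definition dotp (R : realType) (d : nat) (x y : 'cV[R]_d) : R :=
  \sum_(i < d) x i 0 * y i 0.

(** Finite Markov chains *)

Definition is_distr (R : realType) (T : finType) (mu : T -> R) : Prop :=
  (forall x, 0 <= mu x) /\ \sum_(x : T) mu x = 1.

Definition stochastic (R : realType) (T : finType) (K : T -> T -> R) : Prop :=
  forall x, is_distr (K x).

Fixpoint kpow (R : realType) (T : finType) (K : T -> T -> R) (k : nat)
    (x y : T) : R :=
  if k is j.+1 then \sum_(z : T) K x z * kpow K j z y else (x == y)%:R.

Definition stationary (R : realType) (T : finType) (K : T -> T -> R)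
    (mu : T -> R) : Prop :=
  is_distr mu /\ forall y, \sum_(x : T) mu x * K x y = mu y.

Definition irreducible (R : realType) (T : finType) (K : T -> T -> R) : Prop :=
  forall x y, exists k, 0 < kpow K k x y.

(* The return times to each x have greatest common divisor 1. *)
Definition aperiodic (R : realType) (T : finType) (K : T -> T -> R) : Prop :=
  forall (x : T) (g : nat),
    (forall k, (0 < k)%N -> 0 < kpow K k x x -> (g %| k)%N) -> g = 1%N.

Definition tv_dist (R : realType) (T : finType) (mu nu : T -> R) : R :=
  fmax (fun B : {set T} => `| \sum_(x in B) mu x - \sum_(x in B) nu x |).

Definition max_tv (R : realType) (T : finType) (K : T -> T -> R) (mu : T -> R)
    (k : nat) : R :=
  fmax (fun x => tv_dist (kpow K k x) mu).

(* The least k such that max_tv K mu k <= delta (0 when there is none, which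
   does not happen for an ergodic chain and delta > 0). *)
Definition mixing_time (R : realType) (T : finType) (K : T -> T -> R)
    (mu : T -> R) (delta : R) : nat :=
  xget 0%N [set t | max_tv K mu t <= delta /\
                    forall k, max_tv K mu k <= delta -> (t <= k)%N].

(** The MDP under the behavior policy: pi s a stands for pi(a|s) and P a s s'
    for P_a(s,s'). *)

Definition state_chain (R : realType) (S A : finType) (pi : S -> A -> R)
    (P : A -> S -> S -> R) (s s' : S) : R :=
  \sum_(a : A) pi s a * P a s s'.

Definition transition_space (R : realType) (S A : finType) (pi : S -> A -> R)
    (P : A -> S -> S -> R) : finType :=
  {x : S * A * S | (0 < pi x.1.1 x.1.2) && (0 < P x.1.2 x.1.1 x.2)}.

Definition transition_chain (R : realType) (S A : finType) (pi : S -> A -> R)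
    (P : A -> S -> S -> R) (x y : transition_space pi P) : R :=
  let: (s1, a1, s1') := sval y in
  (s1 == (sval x).2)%:R * pi s1 a1 * P a1 s1 s1'.

Definition transition_distr (R : realType) (S A : finType) (pi : S -> A -> R)
    (P : A -> S -> S -> R) (mu : S -> R) (x : transition_space pi P) : R :=
  let: (s, a, s') := sval x in mu s * pi s a * P a s s'.

(* The event S_0 = s_0, A_0 = a_0, ..., A_(k-1) = a_(k-1), S_k = s_k. *)
Definition history (Omega : Type) (S A : Type) (St : nat -> Omega -> S)
    (Ac : nat -> Omega -> A) (s : nat -> S) (a : nat -> A) (k : nat) :
    set Omega :=
  [set w | (forall i, (i <= k)%N -> St i w = s i) /\
           (forall i, (i < k)%N -> Ac i w = a i)].

(* Conditionally on the whole past, A_k ~ pi(.|S_k) and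
   S_(k+1) ~ P_(A_k)(S_k, .); the law of S_0 is arbitrary. *)
Definition is_trajectory (R : realType) (disp : measure_display)
    (Omega : measurableType disp) (Pr : probability Omega R) (S A : finType)
    (pi : S -> A -> R) (P : A -> S -> S -> R)
    (St : nat -> Omega -> S) (Ac : nat -> Omega -> A) : Prop :=
  [/\ forall k s, measurable (St k @^-1` [set s]),
      forall k a, measurable (Ac k @^-1` [set a]),
      forall (k : nat) (s : nat -> S) (a : nat -> A),
        Pr (history St Ac s a k `&` Ac k @^-1` [set a k])
        = (Pr (history St Ac s a k) * (pi (s k) (a k))%:E)%E &
      forall (k : nat) (s : nat -> S) (a : nat -> A),
        Pr (history St Ac s a k `&` Ac k @^-1` [set a k]
            `&` St k.+1 @^-1` [set s k.+1])
        = (Pr (history St Ac s a k `&` Ac k @^-1` [set a k])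
           * (P (a k) (s k) (s k.+1))%:E)%E].

(** Q-learning with linear function approximation *)

(* The basis vectors phi_1, ..., phi_d are functions on state-action pairs. *)
Definition feature (R : realType) (S A : finType) (d : nat)
    (phi : d.-tuple {ffun S * A -> R^o}) (s : S) (a : A) : 'cV[R]_d :=
  \col_(i < d) tnth phi i (s, a).

Definition Qlin (R : realType) (S A : finType) (d : nat)
    (phi : d.-tuple {ffun S * A -> R^o}) (theta : 'cV[R]_d) (s : S) (a : A) :
    R :=
  dotp (feature phi s a) theta.

Definition td_error (R : realType) (S A : finType) (d : nat)
    (phi : d.-tuple {ffun S * A -> R^o}) (rew : S -> A -> R) (gamma : R)
    (theta : 'cV[R]_d) (s : S) (a : A) (s' : S) : R :=
  rew s a + gamma * fmax (fun a' => Qlin phi theta s' a') - Qlin phi theta s a.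

Fixpoint q_iter (R : realType) (S A : finType) (d : nat)
    (phi : d.-tuple {ffun S * A -> R^o}) (rew : S -> A -> R) (gamma : R)
    (theta0 : 'cV[R]_d) (step : nat -> R) (s : nat -> S) (a : nat -> A)
    (k : nat) : 'cV[R]_d :=
  if k is j.+1 then
    let theta := q_iter phi rew gamma theta0 step s a j in
    theta + (step j * td_error phi rew gamma theta (s j) (a j) (s j.+1))
            *: feature phi (s j) (a j)
  else theta0.

(* E[phi(S,A) Delta(theta,S,A,S')] under S ~ mu, A ~ pi(.|S), S' ~ P_A(S,.). *)
Definition mean_update (R : realType) (S A : finType) (d : nat)
    (phi : d.-tuple {ffun S * A -> R^o}) (rew : S -> A -> R) (gamma : R)
    (pi : S -> A -> R) (P : A -> S -> S -> R) (mu : S -> R)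
    (theta : 'cV[R]_d) : 'cV[R]_d :=
  \sum_(s : S) \sum_(a : A) \sum_(s' : S) (mu s * pi s a * P a s s')
    *: (td_error phi rew gamma theta s a s' *: feature phi s a).

(* C and rho are the constants C' and rho' of the geometric mixing bound. *)
Definition assumption_Q1 (R : realType) (S A : finType) (pi : S -> A -> R)
    (P : A -> S -> S -> R) (mu : S -> R) (C rho : R) : Prop :=
  [/\ forall s a, 0 < pi s a,
      irreducible (state_chain pi P) /\ aperiodic (state_chain pi P),
      stationary (state_chain pi P) mu,
      1 <= C /\ 0 < rho < 1 &
      forall k, max_tv (state_chain pi P) mu k <= C * rho ^+ k].

Definition assumption_Q2 (R : realType) (S A : finType) (d : nat)
    (phi : d.-tuple {ffun S * A -> R^o}) (rew : S -> A -> R) (gamma : R)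
    (pi : S -> A -> R) (P : A -> S -> S -> R) (mu : S -> R)
    (theta_star : 'cV[R]_d) (kappa : R) : Prop :=
  [/\ forall theta, mean_update phi rew gamma pi P mu theta = 0 <->
                    theta = theta_star,
      0 < kappa &
      forall theta : 'cV[R]_d,
        gamma ^+ 2 * (\sum_(s : S) mu s
                        * fmax (fun a => Qlin phi theta s a ^+ 2))
        - \sum_(s : S) \sum_(a : A) mu s * pi s a * Qlin phi theta s a ^+ 2
        <= - kappa * l2norm theta ^+ 2].

(* Main.v *)
(** Since the finitely many paths of length k carry explicit weights, every
    expectation is a finite sum over paths.  Write e_k = theta_k - theta*.  By
    (Q2), AM-GM and stationarity, the mean field f satisfies
    <e, f(theta)> <= - kappa/2 |e|^2, so only the Markovian noise in the
    expansion of E|e_(k+1)|^2 has to be controlled.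

    Constant step, t >= 1: theta moves by O(alpha M t) during t - 1 steps.
    Condition on the path up to time k - t + 1: the law of S_k is then within
    alpha of mu_S, because the distance to stationarity of (S_k) after t - 1
    steps from a reachable state is at most that of (X_k) after t steps.  If
    t = 0 and alpha < 1/2 there is a single transition, and the recursion is a
    deterministic contraction.

    Step alpha/(k+h): bounding the mixing times as in the constant step case
    only gives the constant 1/log(1/rho') in place of M1, and M1 can be much
    smaller (take C' = 1 and rho' close to 1).  Instead, a solution V of the
    Poisson equation V - K V = F - f for the state chain K turns the noise into
    a telescoping sum up to O((1 + |e|^2)/k^2), whence E|e_k|^2 = O(1/(k+h)).
    This is below the claimed log(k+h)/(k+h) bound for all large k. *)
Require Import Defs.
From HB Require Import structures.
From mathcomp Require Import all_boot all_order all_algebra.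
From mathcomp Require Import all_classical all_reals all_analysis.
From mathcomp Require Import measurable_realfun ring lra.
Set Implicit Arguments.
Unset Strict Implicit.
Unset Printing Implicit Defensive.
Import Order.TTheory GRing.Theory Num.Theory.
Import numFieldNormedType.Exports.
Local Open Scope classical_set_scope.
Local Open Scope ring_scope.

(** * Euclidean inner product and norm *)

Section EuclideanNorm.
Variables (R : realType) (d : nat).
Implicit Types x y z : 'cV[R]_d.

Lemma dotpC x y : dotp x y = dotp y x.
Proof. by apply: eq_bigr => i _; rewrite mulrC. Qed.

Lemma dotpDl x y z : dotp (x + y) z = dotp x z + dotp y z.
Proof. by rewrite -big_split; apply: eq_bigr => i _; rewrite mxE mulrDl. Qed.

Lemma dotpDr x y z : dotp z (x + y) = dotp z x + dotp z y.
Proof. by rewrite dotpC dotpDl !(dotpC _ z). Qed.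

Lemma dotpZl a x y : dotp (a *: x) y = a * dotp x y.
Proof. by rewrite mulr_sumr; apply: eq_bigr => i _; rewrite mxE mulrA. Qed.

Lemma dotpZr a x y : dotp x (a *: y) = a * dotp x y.
Proof. by rewrite dotpC dotpZl dotpC. Qed.

Lemma dotpBl x y z : dotp (x - y) z = dotp x z - dotp y z.
Proof. by rewrite -scaleN1r dotpDl dotpZl mulN1r. Qed.

Lemma dotpBr x y z : dotp z (x - y) = dotp z x - dotp z y.
Proof. by rewrite dotpC dotpBl !(dotpC _ z). Qed.

Lemma dotp0r x : dotp x 0 = 0.
Proof. by rewrite -(scale0r x) dotpZr mul0r. Qed.

Lemma dotp_sumr (I : finType) (F : I -> 'cV[R]_d) x :
  dotp x (\sum_i F i) = \sum_i dotp x (F i).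
Proof. by apply: big_morph => [u v|]; rewrite (dotpDr, dotp0r). Qed.

Lemma l2norm_ge0 x : 0 <= l2norm x.
Proof. exact: sqrtr_ge0. Qed.

Lemma sqr_l2norm x : l2norm x ^+ 2 = dotp x x.
Proof.
rewrite sqr_sqrtr; last by apply: sumr_ge0 => i _; rewrite sqr_ge0.
by apply: eq_bigr => i _; rewrite expr2.
Qed.

Lemma l2norm_eq0 x : l2norm x = 0 -> x = 0.
Proof.
move=> x0; have /eqP : \sum_(i < d) x i 0 ^+ 2 = 0.
  transitivity (dotp x x); first by apply: eq_bigr => i _; rewrite expr2.
  by rewrite -sqr_l2norm x0 expr0n.
rewrite psumr_eq0 => [/allP xi0|i _]; last exact: sqr_ge0.
apply/colP => i; rewrite mxE; apply/eqP.
by have := xi0 i; rewrite mem_index_enum sqrf_eq0 => /(_ isT).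
Qed.

Lemma l2norm0 : l2norm (0 : 'cV[R]_d) = 0.
Proof. by apply/eqP; rewrite -sqrf_eq0 sqr_l2norm dotp0r. Qed.

(** Cauchy-Schwarz. The squared norm of [l2norm y *: x - l2norm x *: y] is
    [2 |x| |y| (|x| |y| - <x, y>)], and the factor [|x| |y|] can be cancelled when neither norm
    vanishes. *)
Lemma dotp_le_l2norm x y : dotp x y <= l2norm x * l2norm y.
Proof.
have [/l2norm_eq0 ->|x0] := eqVneq (l2norm x) 0.
  by rewrite dotpC dotp0r mulr_ge0 ?l2norm_ge0.
have [/l2norm_eq0 ->|y0] := eqVneq (l2norm y) 0.
  by rewrite dotp0r mulr_ge0 ?l2norm_ge0.
have xy0 : 0 < l2norm x * l2norm y
    by rewrite mulr_gt0 // lt0r ?x0 ?y0 l2norm_ge0.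
have := sqr_ge0 (l2norm (l2norm y *: x - l2norm x *: y)).
have -> : l2norm (l2norm y *: x - l2norm x *: y) ^+ 2
    = l2norm x * l2norm y * (2 * (l2norm x * l2norm y - dotp x y)).
  rewrite sqr_l2norm !(dotpBl, dotpBr, dotpZl, dotpZr) (dotpC y x).
  by rewrite -!sqr_l2norm; ring.
by rewrite pmulr_rge0 // pmulr_rge0 // subr_ge0.
Qed.

Lemma l2normZ a x : l2norm (a *: x) = `|a| * l2norm x.
Proof.
apply: (pexpIrn (ltn0Sn 1)); rewrite ?nnegrE ?mulr_ge0 ?l2norm_ge0 //.
by rewrite exprMn !sqr_l2norm dotpZl dotpZr mulrA -expr2 real_normK ?num_real.
Qed.

Lemma l2normN x : l2norm (- x) = l2norm x.
Proof. by rewrite -scaleN1r l2normZ normrN1 mul1r. Qed.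

Lemma l2norm_distC x y : l2norm (x - y) = l2norm (y - x).
Proof. by rewrite -opprB l2normN. Qed.

Lemma normr_dotp_le x y : `|dotp x y| <= l2norm x * l2norm y.
Proof.
rewrite ler_norml dotp_le_l2norm andbT lerNl -mulN1r -dotpZr scaleN1r.
by rewrite -(l2normN y) dotp_le_l2norm.
Qed.

Lemma sqr_l2normD x y :
  l2norm (x + y) ^+ 2 = l2norm x ^+ 2 + 2 * dotp x y + l2norm y ^+ 2.
Proof. by rewrite !sqr_l2norm !(dotpDl, dotpDr) (dotpC y x); ring. Qed.

Lemma l2normD_le x y : l2norm (x + y) <= l2norm x + l2norm y.
Proof.
have xy0 : 0 <= l2norm x + l2norm y by rewrite addr_ge0 ?l2norm_ge0.
rewrite -ler_sqr ?nnegrE ?l2norm_ge0 // sqr_l2normD.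
by have := dotp_le_l2norm x y; nra.
Qed.

Lemma l2norm_le_dist x y : l2norm x <= l2norm y + l2norm (x - y).
Proof. by rewrite -{1}(subrKC y x) l2normD_le. Qed.

Lemma l2norm_delta (i : 'I_d) : l2norm (delta_mx i 0 : 'cV[R]_d) = 1.
Proof.
apply: (pexpIrn (ltn0Sn 1)); rewrite ?nnegrE ?l2norm_ge0 // sqr_l2norm.
rewrite /dotp (bigD1 i) //= big1 => [|j ji];
  first by rewrite !mxE !eqxx mulr1 addr0 expr1n.
by rewrite !mxE (negPf ji) mul0r.
Qed.

End EuclideanNorm.

(** * Maxima over finite types *)

Section FiniteMaximum.
Variables (R : realType) (T : finType).
Implicit Types F G : T -> R.

Lemma fmax_ge F x : F x <= fmax F.
Proof. by rewrite /fmax; case: pickP => [x0 _|/(_ x)//]; exact: le_bigmax. Qed.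

Lemma fmax_attained (x0 : T) F : exists x, fmax F = F x.
Proof.
rewrite /fmax; case: pickP => [x _|/(_ x0)//].
apply: (big_ind (fun c => exists y, c = F y)) => [|_ _ [y ->] [z ->]|y _];
  [by exists x| |by exists y].
by case: leP => _; [exists z|exists y].
Qed.

Lemma fmax_le (x0 : T) F c : (forall x, F x <= c) -> fmax F <= c.
Proof. by have [x ->] := fmax_attained x0 F. Qed.

(** The witness is a maximizer of whichever function has the larger maximum: there the other
    function is at most its own maximum. *)
Lemma fmax_dist (x0 : T) F G : exists x, `|fmax F - fmax G| <= `|F x - G x|.
Proof.
have [x Fx] := fmax_attained x0 F; have [y Gy] := fmax_attained x0 G.
have [le_GF|/ltW le_FG] := leP (fmax G) (fmax F).
- exists x; rewrite ger0_norm ?subr_ge0 // Fx.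
  by apply: le_trans (ler_norm _); rewrite lerD2l lerN2 fmax_ge.
- exists y; rewrite distrC ger0_norm ?subr_ge0 // Gy distrC.
  by apply: le_trans (ler_norm _); rewrite lerD2l lerN2 fmax_ge.
Qed.

End FiniteMaximum.

(** * Total variation against the l1 distance *)

Section TotalVariation.
Variables (R : realType) (T : finType).
Implicit Types mu nu : T -> R.

(** The sum splits over the set where [nu x <= mu x] and its complement; on each the differences
    have constant sign, so each part is at most one [tv_dist]. *)
Lemma sum_dist_le_tv mu nu : \sum_x `|mu x - nu x| <= 2 * tv_dist mu nu.
Proof.
have tv (B : {set T}) : `|\sum_(x in B) (mu x - nu x)| <= tv_dist mu nu.
  by rewrite sumrB; apply: (fmax_ge (fun B : {set T} => `|_ - _|)).
pose B := [set x | nu x <= mu x]%SET.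
rewrite (bigID (mem B)) /= mulr_natl mulr2n; apply: lerD.
- apply: le_trans (tv B).
  rewrite [leRHS]ger0_norm; last by apply: sumr_ge0 => x; rewrite inE subr_ge0.
  by apply: ler_sum => x; rewrite inE => le_nm; rewrite ger0_norm ?subr_ge0.
- apply: le_trans (tv (~: B)%SET).
  rewrite -normrN -sumrN [leRHS]ger0_norm; last first.
    by apply: sumr_ge0 => x; rewrite !inE opprB subr_ge0 -ltNge => /ltW.
  under [leRHS]eq_bigl do rewrite finset.in_setC.
  apply: ler_sum => x; rewrite !inE -ltNge => /ltW le_mn.
  by rewrite distrC opprB ger0_norm ?subr_ge0.
Qed.

Lemma tv_le_sum_dist mu nu : tv_dist mu nu <= \sum_x `|mu x - nu x|.
Proof.
apply: (fmax_le (finset.set0 : {set T})) => B; rewrite -sumrB.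
apply: le_trans (ler_norm_sum _ _ _) _.
rewrite [leRHS](bigID (mem B)) /= lerDl; exact: sumr_ge0.
Qed.

End TotalVariation.

(** * Powers of a finite kernel *)

Section MarkovKernel.
Variables (R : realType) (T : finType) (K : T -> T -> R).
Hypothesis K_stochastic : stochastic K.

Lemma sum_kpow k x : \sum_y kpow K k x y = 1.
Proof.
elim: k x => [|k IHk] x /=.
  by rewrite (bigD1 x) //= eqxx big1 ?addr0 // => y;
    rewrite eq_sym => /negPf ->.
rewrite exchange_big /=; under eq_bigr do rewrite -mulr_sumr IHk mulr1.
exact: (K_stochastic x).2.
Qed.

Lemma kpow0_mean x (g : T -> R) : \sum_y kpow K 0 x y * g y = g x.
Proof.
rewrite (bigD1 x) //= eqxx mul1r big1 ?addr0 // => y; rewrite eq_sym.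
by move=> /negPf ->; rewrite mul0r.
Qed.

(** [kpow] unfolds at the first step, whereas paths are extended at their end. *)
Lemma kpowSr k x y : kpow K k.+1 x y = \sum_z kpow K k x z * K z y.
Proof.
elim: k x => [|k IHk] x; first rewrite kpow0_mean /=.
  by under eq_bigr do rewrite eq_sym mulrC; exact: kpow0_mean.
transitivity (\sum_z K x z * kpow K k.+1 z y) => //.
under eq_bigr do rewrite IHk mulr_sumr.
rewrite exchange_big /=; apply: eq_bigr => z _.
by rewrite mulr_suml; apply: eq_bigr => u _; rewrite mulrA.
Qed.

End MarkovKernel.

(** * One-step means and weighted finite paths *)

Section Transitions.
Variables (R : realType) (S A : finType).
Variables (pi : S -> A -> R) (P : A -> S -> S -> R).
Hypothesis pi_distr : forall s, is_distr (pi s).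
Hypothesis P_stochastic : forall a, stochastic (P a).

Definition step_mean (s : S) (g : A -> S -> R) : R :=
  \sum_a \sum_s' pi s a * P a s s' * g a s'.

Lemma step_weight_ge0 s a s' : 0 <= pi s a * P a s s'.
Proof. by rewrite mulr_ge0 ?(pi_distr s).1 ?(P_stochastic a s).1. Qed.

Lemma step_meanD s f g :
  step_mean s (fun a s' => f a s' + g a s') = step_mean s f + step_mean s g.
Proof.
rewrite -big_split; apply: eq_bigr => a _.
by rewrite -big_split; apply: eq_bigr => s' _; rewrite mulrDr.
Qed.

Lemma step_meanZ s c f : step_mean s (fun a s' => c * f a s')
  = c * step_mean s f.
Proof.
rewrite mulr_sumr; apply: eq_bigr => a _; rewrite mulr_sumr.
by apply: eq_bigr => s' _; rewrite mulrCA.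
Qed.

Lemma step_mean_action s (f : A -> R) :
  step_mean s (fun a _ => f a) = \sum_a pi s a * f a.
Proof.
apply: eq_bigr => a _; rewrite -mulr_suml -mulr_sumr.
by rewrite (P_stochastic a s).2 mulr1.
Qed.

Lemma step_mean_cst s c : step_mean s (fun _ _ => c) = c.
Proof. by rewrite step_mean_action -mulr_suml (pi_distr s).2 mul1r. Qed.

Lemma step_mean_state s (f : S -> R) :
  step_mean s (fun _ s' => f s') = \sum_s' state_chain pi P s s' * f s'.
Proof.
rewrite /step_mean exchange_big; apply: eq_bigr => s' _.
by rewrite -mulr_suml.
Qed.

Lemma step_mean_le s f g : (forall a s', f a s' <= g a s') ->
  step_mean s f <= step_mean s g.
Proof.
move=> fg; apply: ler_sum => a _; apply: ler_sum => s' _.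
by rewrite ler_wpM2l ?step_weight_ge0.
Qed.

Lemma normr_step_mean_le s f c : (forall a s', `|f a s'| <= c) ->
  `|step_mean s f| <= c.
Proof.
move=> fc; rewrite ler_norml -{1}(step_mean_cst s (- c))
  -{2}(step_mean_cst s c).
by apply/andP; split; apply: step_mean_le => a s'; move: (fc a s');
  rewrite ler_norml => /andP[].
Qed.

Lemma state_chain_stochastic : stochastic (state_chain pi P).
Proof.
move=> s; split=> [s'|].
  by apply: sumr_ge0 => a _; exact: step_weight_ge0.
rewrite -[RHS](step_mean_cst s 1) step_mean_state.
by apply: eq_bigr => s' _; rewrite mulr1.
Qed.

Variable mu0 : S -> R.
Hypothesis mu0_distr : is_distr mu0.

(* A path records S_0, (A_0, S_1), ..., (A_(k-1), S_k). *)
Fixpoint traj (k : nat) : finType :=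
  if k is j.+1 then (traj j * (A * S))%type else S.

Definition traj_end k : traj k -> S :=
  if k is j.+1 return traj k -> S then fun h => h.2.2 else id.

Fixpoint traj_weight k : traj k -> R :=
  if k is j.+1 return traj k -> R then
    fun h => traj_weight h.1
             * (pi (traj_end h.1) h.2.1 * P h.2.1 (traj_end h.1) h.2.2)
  else mu0.

Definition traj_mean k (g : traj k -> R) : R := \sum_h traj_weight h * g h.

Lemma traj_weight_ge0 k (h : traj k) : 0 <= traj_weight h.
Proof.
elim: k h => [|k IHk] h /=; first exact: mu0_distr.1.
by rewrite mulr_ge0 ?step_weight_ge0.
Qed.

Lemma traj_meanS k (g : traj k.+1 -> R) :
  traj_mean g = traj_mean
    (fun h => step_mean (traj_end h) (fun a s => g (h, (a, s)))).
Proof.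
have sum3 (T : finType) (F : T * (A * S) -> R) :
    \sum_h F h = \sum_h \sum_a \sum_s F (h, (a, s)).
  under [RHS]eq_bigr do rewrite pair_bigA.
  by rewrite pair_bigA; apply: eq_bigr; case=> [h [a s]].
rewrite /traj_mean (sum3 (traj k)); apply: eq_bigr => h _ /=.
rewrite mulr_sumr; apply: eq_bigr => a _; rewrite mulr_sumr.
by apply: eq_bigr => s _; rewrite -!mulrA.
Qed.

Lemma eq_traj_mean k (f g : traj k -> R) : f =1 g -> traj_mean f = traj_mean g.
Proof. by move=> fg; apply: eq_bigr => h _; rewrite fg. Qed.

Lemma traj_meanD k (f g : traj k -> R) :
  traj_mean (fun h => f h + g h) = traj_mean f + traj_mean g.
Proof. by rewrite -big_split; apply: eq_bigr => h _; rewrite mulrDr. Qed.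

Lemma traj_meanZ k c (f : traj k -> R) :
  traj_mean (fun h => c * f h) = c * traj_mean f.
Proof. by rewrite mulr_sumr; apply: eq_bigr => h _; rewrite mulrCA. Qed.

Lemma traj_mean_cst k c : traj_mean (fun _ : traj k => c) = c.
Proof.
elim: k => [|k IHk].
  by rewrite /traj_mean -mulr_suml mu0_distr.2 mul1r.
by rewrite traj_meanS -[RHS]IHk; apply: eq_traj_mean => h; exact: step_mean_cst.
Qed.

(** The restriction to paths of positive weight matters in the constant step case, where mixing is
    known only from states entered by a transition of positive probability. *)
Lemma traj_mean_le_supp k (f g : traj k -> R) :
  (forall h, 0 < traj_weight h -> f h <= g h) -> traj_mean f <= traj_mean g.
Proof.
move=> fg; apply: ler_sum => h _.
have := traj_weight_ge0 h; rewrite le_eqVlt => /predU1P[<-|h0].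
  by rewrite !mul0r.
by rewrite ler_pM2l // fg.
Qed.

Lemma traj_mean_le k (f g : traj k -> R) :
  (forall h, f h <= g h) -> traj_mean f <= traj_mean g.
Proof. by move=> fg; apply: traj_mean_le_supp => h _. Qed.

Lemma traj_mean_ge0 k (f : traj k -> R) :
  (forall h, 0 <= f h) -> 0 <= traj_mean f.
Proof. by move=> f0; rewrite -(traj_mean_cst k 0) traj_mean_le. Qed.

(** Recursion on [t] in [t + k] lets the last [t] transitions be dropped without any cast. *)
Fixpoint traj_past t k : traj (t + k) -> traj k :=
  if t is j.+1 return traj (t + k) -> traj k then
    fun h => traj_past h.1
  else id.

Lemma traj_mean_past t k (G : traj k -> R) :
  traj_mean (fun h : traj (t + k) => G (traj_past h)) = traj_mean G.
Proof.
elim: t => [//|t IHt]; rewrite -IHt traj_meanS.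
by apply: eq_traj_mean => h; exact: (step_mean_cst _ (G (traj_past h))).
Qed.

(** The Markov property: given the first [k] transitions, the state [t] steps later is distributed
    as the [t]-th power of the state chain. Each induction step averages out the last transition,
    which replaces [G h] by its image under the kernel. *)
Lemma traj_mean_markov t k (G : traj k -> S -> R) :
  traj_mean (fun h : traj (t + k) => G (traj_past h) (traj_end h))
  = traj_mean (fun h =>
      \sum_s kpow (state_chain pi P) t (traj_end h) s * G h s).
Proof.
elim: t G => [|t IHt] G.
  by apply: eq_traj_mean => h /=; rewrite kpow0_mean.
rewrite traj_meanS; under eq_traj_mean => h do rewrite /= step_mean_state.
rewrite (IHt (fun h s => \sum_s' state_chain pi P s s' * G h s')).
apply: eq_traj_mean => h.
under [RHS]eq_bigr do rewrite kpowSr mulr_suml.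
rewrite exchange_big /=; apply: eq_bigr => z _.
by rewrite mulr_sumr; apply: eq_bigr => u _; rewrite mulrA.
Qed.

End Transitions.

(** * From the probability space to finite path sums *)

Section TrajectoryLaw.
Variables (R : realType) (S A : finType).

(** The integrand is a finite sum of constants times indicators of the fibres of [H]; nonnegativity
    allows integral and sum to be exchanged. *)
Lemma expectation_finite (disp : measure_display) (Omega : measurableType disp)
    (Pr : probability Omega R) (T : finType) (H : Omega -> T) (p g : T -> R) :
  (forall h, measurable (H @^-1` [set h])) ->
  (forall h, Pr (H @^-1` [set h]) = (p h)%:E) ->
  (forall h, 0 <= g h) ->
  ('E_Pr[fun w => g (H w)] = (\sum_h p h * g h)%:E)%E.
Proof.
move=> mH pH g0; rewrite unlock.
pose f (h : T) w : \bar R := ((g h)%:E * (\1_(H @^-1` [set h]) w)%:E)%E.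
transitivity (\int[Pr]_w \sum_(h <- index_enum T) f h w)%E.
  apply: eq_integral => w _; rewrite (bigD1 (H w)) //= big1 => [|h hw].
    by rewrite /f indicE mem_set ?mule1 ?adde0.
  by rewrite /f indicE memNset ?mule0 // => /= e; rewrite -e eqxx in hw.
rewrite ge0_integral_sum //; last first.
- by move=> h w _; rewrite mule_ge0 ?lee_fin // indicE ler0n.
- move=> h; apply: measurable_funeM; apply/measurable_EFinP.
  exact: measurable_indic.
rewrite -sumEFin; apply: eq_bigr => h _.
rewrite ge0_integralZl_EFin //; last 1 first.
- by apply/measurable_EFinP; exact: measurable_indic.
- by rewrite integral_indic // setIT mulrC EFinM; congr (_ * _)%E; exact: pH.
Qed.

Fixpoint traj_of (s : nat -> S) (a : nat -> A) k : traj S A k :=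
  if k is j.+1 return traj S A k then (traj_of s a j, (a j, s j.+1)) else s 0%N.

Lemma traj_end_of s a k : traj_end (traj_of s a k) = s k.
Proof. by case: k. Qed.

Lemma eq_traj_of s a s' a' k :
  (forall i, (i <= k)%N -> s i = s' i) -> (forall i, (i < k)%N -> a i = a' i) ->
  traj_of s a k = traj_of s' a' k.
Proof.
elim: k => [|k IHk] ss aa /=; first exact: ss.
rewrite IHk ?aa ?ss // => i ik; [exact/ss/ltnW|exact/aa/ltnW].
Qed.

(** [is_trajectory] speaks of infinite sequences; this extends a finite path to such sequences, with
    [a0] as a filler for the later actions. *)
Lemma traj_of_surj (a0 : A) k (h : traj S A k) : exists s a, h = traj_of s a k.
Proof.
elim: k h => [|k IHk] h; first by exists (fun=> h), (fun=> a0).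
case: h => h [b z]; have [s [a ->]] := IHk h.
exists (fun i => if i == k.+1 then z else s i),
  (fun i => if i == k then b else a i).
rewrite /= !eqxx; congr pair; apply: eq_traj_of => i ik.
- by rewrite ltn_eqF.
- by rewrite ltn_eqF.
Qed.

Variables (disp : measure_display) (Omega : measurableType disp).
Variables (Pr : probability Omega R) (St : nat -> Omega -> S)
  (Ac : nat -> Omega -> A).

Let Tr k w : traj S A k := traj_of (St^~ w) (Ac^~ w) k.

Lemma history_traj_of s a k :
  history St Ac s a k = Tr k @^-1` [set traj_of s a k].
Proof.
elim: k => [|k IHk]; apply/seteqP; split => w /=.
- by case=> ss _; exact: ss.
- by move=> /= sw; split => // i; rewrite leqn0 => /eqP ->.
- by case=> ss aa; exact: (@eq_traj_of _ _ _ _ k.+1).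
- case=> /= hk aw sw; have : history St Ac s a k w by rewrite IHk.
  case=> ss aa; split=> i.
    by rewrite leq_eqVlt ltnS => /predU1P[->|/ss].
  by rewrite ltnS leq_eqVlt => /predU1P[->|/aa].
Qed.

Lemma historyS s a k : history St Ac s a k.+1 =
  history St Ac s a k `&` Ac k @^-1` [set a k] `&` St k.+1 @^-1` [set s k.+1].
Proof.
rewrite !history_traj_of; apply/seteqP; split => w.
  by case=> e1 e2 e3; split; [split|].
by case=> -[e1 e2] e3; congr (_, (_, _)).
Qed.

Variables (pi : S -> A -> R) (P : A -> S -> S -> R).
Hypothesis Tr_law : is_trajectory Pr pi P St Ac.

Let mu0 (s : S) : R := fine (Pr (St 0%N @^-1` [set s])).

Lemma measurable_history s a k : measurable (history St Ac s a k).
Proof.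
have [mS mA _ _] := Tr_law; rewrite history_traj_of.
elim: k => [|k IHk]; first exact: mS.
rewrite -history_traj_of historyS; apply: measurableI => //.
by apply: measurableI => //; rewrite history_traj_of.
Qed.

Lemma history_law s a k :
  Pr (history St Ac s a k) = (traj_weight pi P mu0 (traj_of s a k))%:E.
Proof.
have [mS mA hA hS] := Tr_law; elim: k => [|k IHk].
  by rewrite history_traj_of /= fineK // fin_num_measure.
by rewrite historyS hS hA IHk -!EFinM /= !traj_end_of mulrA.
Qed.

Lemma initial_law_distr : is_distr mu0.
Proof.
have [mS mA _ _] := Tr_law; split=> [s|]; first exact: fine_ge0.
apply: EFin_inj; rewrite -(probability_setT Pr).
have := @expectation_finite _ _ Pr _ (St 0%N) mu0 (fun=> 1) (mS 0%N).
rewrite expectation_cst probability_setT => ->; last 2 first.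
- by move=> s; rewrite fineK // fin_num_measure.
- by [].
by congr EFin; apply: eq_bigr => s _; rewrite mulr1.
Qed.

Lemma expectation_traj (a0 : A) k (g : traj S A k -> R) :
  (forall h, 0 <= g h) ->
  ('E_Pr[fun w => g (traj_of (St^~ w) (Ac^~ w) k)]
    = (traj_mean pi P mu0 g)%:E)%E.
Proof.
move=> g0; apply: expectation_finite => // h;
  have [s [a ->]] := traj_of_surj a0 h; rewrite -history_traj_of.
- exact: measurable_history.
- exact: history_law.
Qed.

End TrajectoryLaw.

(** * A scalar recursion and the Poisson equation *)

(* With [n = k + h], the corrected sequence [L k = x k + 2 (alpha / n) D k]
   satisfies [L (k+1) <= (1 - 2/n) L k + B/n^2] for large [n], because
   [kappa alpha > 2]; hence [L k = O(1/n)]. *)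
Lemma corrected_drift_rate (R : realType) (x D : nat -> R)
    (C kappa alpha h : R) :
  0 <= C -> 0 < alpha -> 0 < kappa -> 2 < kappa * alpha -> 0 < h ->
  (forall k, 0 <= x k) ->
  (forall k, `|D k| <= C * (1 + x k)) ->
  (forall k, x k.+1 <= C * (1 + x k)) ->
  (forall k, x k.+1 <= (1 - kappa * (alpha / (k%:R + h))) * x k
     + 2 * (alpha / (k%:R + h)) * (D k - D k.+1)
     + C * (alpha / (k%:R + h)) ^+ 2 * (1 + x k)) ->
  exists G N, forall k, (N <= k)%N -> x k <= G / (k%:R + h).
Proof.
move=> C0 alpha0 kappa0 ka2 h0 x0 D_le x_next rec.
pose q k : R := (k%:R + h)^-1.
have n0 k : 0 < k%:R + h by rewrite ltr_wpDl.
have q0 k : 0 < q k by rewrite invr_gt0.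
have qS k : q k - q k ^+ 2 <= q k.+1 /\
    q k - q k.+1 <= q k ^+ 2 /\ q k.+1 <= q k.
  have nS : k.+1%:R + h = (k%:R + h) + 1 by rewrite -natr1 addrAC.
  have qn : q k * (k%:R + h) = 1 by rewrite mulVf ?gt_eqF.
  have qSn : q k.+1 * (k%:R + h) + q k.+1 = 1.
    by rewrite -[X in _ + X]mulr1 -mulrDr -nS mulVf ?gt_eqF.
  have e : q k - q k.+1 = q k * q k.+1.
    have -> : q k - q k.+1
        = q k * (q k.+1 * (k%:R + h) + q k.+1) - q k.+1 * (q k * (k%:R + h)).
      by rewrite qn qSn !mulr1.
    by ring.
  have le_q : q k.+1 <= q k.
    by rewrite -subr_ge0 e mulr_ge0 // ltW.
  have : q k * q k.+1 <= q k * q k by rewrite ler_wpM2l // ltW.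
  by rewrite -e => eq2; split; [|split]; rewrite ?expr2; lra.
pose L k := x k + 2 * (alpha * q k) * D k.
pose eps := kappa * alpha - 2.
(* The three summands come from replacing [x] by [L] in the contraction, from the quadratic term of
   the recursion, and from the change of the coefficient of [D k.+1]. The leading 2 pays for
   [1 + x k <= 2 * (1 + L k)]. *)
pose B := 2 * (2 * kappa * alpha ^+ 2 * C + C * alpha ^+ 2
               + 2 * alpha * C * (1 + C)).
have eps0 : 0 < eps by rewrite subr_gt0.
have B0 : 0 <= B.
  have a2 := sqr_ge0 alpha; have a0 := ltW alpha0; have k0 := ltW kappa0.
  by rewrite /B mulr_ge0 // !addr_ge0 ?mulr_ge0 ?addr_ge0 // mulr_ge0.
(* Beyond [N] the correction is at most half of [1 + x k], the noise [B * q k] fits into the slack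
   [eps], and the contraction factor is nonnegative. *)
pose N := Num.bound (4 * alpha * C + B / eps + kappa * alpha).
have large k : (N <= k)%N ->
    [/\ 4 * (alpha * q k) * C <= 1, B * q k <= eps
      & kappa * (alpha * q k) <= 1].
  move=> Nk; have ac : 0 <= 4 * alpha * C by rewrite !mulr_ge0 // ltW.
  have be : 0 <= B / eps by rewrite divr_ge0 // ltW.
  have ka : 0 <= kappa * alpha by rewrite mulr_ge0 ?ltW.
  have : 4 * alpha * C + B / eps + kappa * alpha <= k%:R + h.
    apply: (@le_trans _ _ N%:R).
      by apply/ltW/archi_boundP; rewrite !addr_ge0.
    by rewrite -[leLHS]addr0 lerD ?ler_nat // ltW.
  move=> big; split.
  - by rewrite mulrA mulrAC ler_pdivrMr // mul1r; lra.
  - rewrite ler_pdivrMr // mulrC -ler_pdivrMr //; lra.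
  - by rewrite mulrA ler_pdivrMr // mul1r; lra.
have x_le_L k : (N <= k)%N -> 1 + x k <= 2 * (1 + L k) /\
    x k <= 2 * (L k + 2 * alpha * C * q k).
  move=> /large[q1 _ _]; have := D_le k; rewrite ler_norml => /andP[D1 _].
  have aq0 : 0 <= 2 * (alpha * q k) by rewrite !mulr_ge0 // ltW.
  have := ler_wpM2l aq0 D1.
  have : 4 * (alpha * q k) * C * (1 + x k) <= 1 * (1 + x k).
    by rewrite ler_wpM2r // addr_ge0.
  have := ler_wpM2r (x0 k) q1.
  have := x0 k; rewrite /L => H1 H2 H3 H4; split; lra.
have L_step k : (N <= k)%N -> L k.+1 <=
    (1 - kappa * (alpha * q k)) * L k + B * q k ^+ 2 * (1 + L k).
  move=> Nk; have [xL _] := x_le_L k Nk; have [_ [dq leq]] := qS k.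
  have Dk : D k <= C * (1 + x k) by apply: le_trans (ler_norm _) (D_le k).
  have DS : - D k.+1 <= C * ((1 + C) * (1 + x k)).
    have := D_le k.+1; rewrite ler_norml => /andP[DS _].
    rewrite lerNl; apply: le_trans DS; rewrite lerN2 ler_wpM2l //.
    by have := x_next k; have := x0 k; lra.
  have a0 := ltW alpha0; have k0 := ltW kappa0.
  have t1 : 2 * (alpha * (q k - q k.+1)) * - D k.+1
      <= 2 * (alpha * q k ^+ 2) * (C * ((1 + C) * (1 + x k))).
    apply: (@le_trans _ _
      (2 * (alpha * (q k - q k.+1)) * (C * ((1 + C) * (1 + x k))))).
      by rewrite ler_wpM2l // !mulr_ge0 // subr_ge0.
    rewrite ler_wpM2r ?mulr_ge0 ?addr_ge0 // ler_wpM2l // ler_wpM2l //.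
  have t2 : 2 * kappa * (alpha * q k) ^+ 2 * D k
      <= 2 * kappa * (alpha * q k) ^+ 2 * (C * (1 + x k)).
    by rewrite ler_wpM2l // mulr_ge0 ?sqr_ge0 // mulr_ge0.
  have t3 : B * q k ^+ 2 * (1 + x k) <= B * q k ^+ 2 * (2 * (1 + L k)).
    by rewrite ler_wpM2l // mulr_ge0 // sqr_ge0.
  have := rec k; rewrite -/(q k).
  rewrite /L /B in t3 *; lra.
(* The second argument starts the induction at [N]. The first closes it:
   [(1 - 2 q) G q + B q^2 <= G (q - q^2)], which is at most [G * q k.+1]. *)
pose G := Num.max B (L N * (N%:R + h)).
have BG : B <= G by rewrite le_max lexx.
have G0 : 0 <= G by apply: le_trans BG.
have L_le j : L (N + j)%N <= G * q (N + j)%N.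
  elim: j => [|j IHj].
    by rewrite addn0 ler_pdivlMr // le_max lexx orbT.
  have Nj : (N <= N + j)%N by rewrite leq_addr.
  rewrite addnS; apply: le_trans (L_step _ Nj) _; have [_ Bq kq] := large _ Nj.
  set k := (N + j)%N in IHj Bq kq *; have [q1 _] := qS k.
  have qk0 := ltW (q0 k).
  have c1 : 0 <= 1 - kappa * (alpha * q k) + B * q k ^+ 2.
    by rewrite addr_ge0 ?subr_ge0 // mulr_ge0 // sqr_ge0.
  have c2 : B * q k ^+ 2 <= eps * q k by rewrite expr2 mulrA ler_wpM2r.
  have c3 := ler_wpM2l c1 IHj.
  have c4 : (1 - kappa * (alpha * q k) + B * q k ^+ 2) * (G * q k)
      <= (1 - 2 * q k) * (G * q k).
    by rewrite ler_wpM2r ?mulr_ge0 //; rewrite /eps in c2; lra.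
  have c5 : B * q k ^+ 2 <= G * q k ^+ 2 by rewrite ler_wpM2r // sqr_ge0.
  have c6 := ler_wpM2l G0 q1.
  by lra.
exists (2 * (G + 2 * alpha * C)), N => k Nk; have [_ xL] := x_le_L k Nk.
apply: le_trans xL _; have := L_le (k - N)%N; rewrite subnKC // -/(q k).
by move=> Lk; lra.
Qed.

(* [I - K + 1 mu] is invertible: its kernel consists of [K]-invariant functions
   of mean zero, and mixing makes those vanish. *)
Lemma poisson_kernel (R : realType) (T : finType) (K : T -> T -> R)
  (mu : T -> R) k :
  stochastic K -> stationary K mu ->
  (forall x, \sum_y `|kpow K k x y - mu y| <= 1 / 2) ->
  exists Z : T -> T -> R,
    forall x y, Z x y - \sum_z K x z * Z z y = (x == y)%:R - mu y.
Proof.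
move=> K_st mu_st mix; have [[mu0 mu1] muK] := mu_st.
have sum_ord (F : T -> R) : \sum_(i < #|T|) F (enum_val i) = \sum_x F x.
  by rewrite [RHS](reindex _ (onW_bij _ (enum_val_bij T))).
have mu_mean (F : T -> R) : \sum_x mu x * (\sum_z K x z * F z)
    = \sum_x mu x * F x.
  under eq_bigr do rewrite mulr_sumr.
  rewrite exchange_big; apply: eq_bigr => z _.
  by rewrite -[in RHS]muK mulr_suml; apply: eq_bigr => x _; rewrite mulrA.
pose W : 'M[R]_#|T| := \matrix_(i, j)
  ((i == j)%:R - K (enum_val i) (enum_val j) + mu (enum_val j)).
have W_app (F : T -> R) i : \sum_j W i j * F (enum_val j)
    = F (enum_val i) - \sum_z K (enum_val i) z * F z + \sum_z mu z * F z.
  under eq_bigr do rewrite mxE mulrDl mulrBl.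
  rewrite big_split sumrB /= (sum_ord (fun z => K (enum_val i) z * F z)).
  rewrite (sum_ord (fun z => mu z * F z)) (bigD1 i) //= eqxx mul1r big1 ?addr0
    //.
  by move=> j; rewrite eq_sym => /negPf ->; rewrite mul0r.
have W_unit : W \in unitmx.
  rewrite unitmxE unitfE -det_tr; apply/det0P => -[v v0 vW].
  pose F x := v 0 (enum_rank x).
  have WF x : F x - \sum_z K x z * F z + \sum_z mu z * F z = 0.
    rewrite -{1 2}(enum_rankK x) -(W_app F).
    have := congr1 (fun u : 'rV_#|T| => u 0 (enum_rank x)) vW;
        rewrite !mxE => vW_x; rewrite -[RHS]vW_x.
    by apply: eq_bigr => j _; rewrite !mxE /F enum_valK mulrC.
  have mu_F : \sum_z mu z * F z = 0.
    have : \sum_x mu x * (F x - \sum_z K x z * F z + \sum_z mu z * F z) = 0.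
      by rewrite big1 // => x _; rewrite WF mulr0.
    under eq_bigr do rewrite mulrDr mulrBr.
    by rewrite big_split sumrB /= mu_mean subrr add0r -mulr_suml mu1 mul1r.
  have KF x : \sum_z K x z * F z = F x.
    by have := WF x; rewrite mu_F addr0 => /eqP;
      rewrite subr_eq0 eq_sym => /eqP.
  have KkF n x : \sum_z kpow K n x z * F z = F x.
    elim: n x => [|n IHn] x; first exact: kpow0_mean.
    rewrite -[RHS]KF /=; under eq_bigr do rewrite mulr_suml.
    rewrite exchange_big; apply: eq_bigr => z _.
    by rewrite -[in RHS]IHn mulr_sumr; apply: eq_bigr => y _; rewrite mulrA.
  have F0 x : `|F x| <= 0.
    (* [F] is invariant with mean zero, so [F = (K^k - mu) F]; the mixing hypothesis then bounds its
       sup norm [m] by [m / 2]. *)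
    pose m := fmax (fun x => `|F x|).
    suff m0 : m <= 0 by apply: le_trans (fmax_ge (fun x => `|F x|) x) m0.
    have [y my] := fmax_attained x (fun x => `|F x|).
    suff : m <= 1 / 2 * m by lra.
    have Fy : F y = \sum_z (kpow K k y z - mu z) * F z.
      by under eq_bigr do rewrite mulrBl; rewrite sumrB KkF mu_F subr0.
    rewrite {1}/m my {1}Fy.
    apply: le_trans (ler_norm_sum _ _ _) _.
    apply: (@le_trans _ _ (\sum_z `|kpow K k y z - mu z| * m)).
      apply: ler_sum => z _; rewrite normrM ler_wpM2l //.
      exact: (fmax_ge (fun x => `|F x|)).
    rewrite -mulr_suml ler_wpM2r //.
    exact: le_trans (normr_ge0 (F x)) (fmax_ge (fun x => `|F x|) x).
  case/eqP: v0; apply/rowP => i; rewrite mxE.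
  have := F0 (enum_val i); rewrite /F enum_valK normr_le0 => /eqP //.
pose Z x y := invmx W (enum_rank x) (enum_rank y).
have WZ x y : Z x y - \sum_z K x z * Z z y + \sum_z mu z * Z z y = (x == y)%:R.
  have := congr1 (fun U : 'M[R]_#|T| => U (enum_rank x) (enum_rank y))
      (mulmxV W_unit).
  rewrite !mxE (inj_eq enum_rank_inj) => <-.
  rewrite -{1 2}(enum_rankK x) -(W_app (fun z => Z z y)).
  by apply: eq_bigr => j _; rewrite /Z enum_valK.
(* Averaging [WZ] under [mu] gives [\sum_z mu z * Z z y = mu y], so the rank-one term of [W] becomes
   the [- mu y] of the claim. *)
exists Z; move=> x y; rewrite -WZ -[LHS]addr0 -[RHS]addrA; congr (_ + _).
apply/esym/eqP; rewrite subr_eq0; apply/eqP.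
have : \sum_x mu x * (Z x y - \sum_z K x z * Z z y + \sum_z mu z * Z z y)
    = mu y.
  under eq_bigr do rewrite WZ mulrC eq_sym.
  by rewrite (kpow0_mean K y).
under eq_bigr do rewrite mulrDr mulrBr.
by rewrite big_split sumrB /= (mu_mean (fun z => Z z y)) subrr add0r -mulr_suml
  mu1 mul1r.
Qed.

(** * Bounds on the update direction *)

Section QLearning.
Variables (R : realType) (S A : finType) (d : nat).
Variables (phi : d.-tuple {ffun S * A -> R^o}) (rew : S -> A -> R).
Variables (rmax gamma : R) (pi : S -> A -> R) (P : A -> S -> S -> R).
Variables (a0 : A) (s0 : S).
Hypothesis P_stochastic : forall a, stochastic (P a).
Hypothesis rew_bounds : forall s a, 0 <= rew s a <= rmax.
Hypothesis gamma_bounds : 0 < gamma < 1.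
Hypothesis phi_norm : forall s a, l2norm (feature phi s a) <= 1.
Hypothesis pi_distr : forall s, is_distr (pi s).

Implicit Types (theta e : 'cV[R]_d) (s : S) (a : A).

Local Notation M := (1 + gamma + rmax).
Local Notation Q := (Qlin phi).
Local Notation Qmax theta s := (fmax (fun a => Q theta s a)).
Local Notation delta := (td_error phi rew gamma).

Definition td_dir theta s a s' : 'cV[R]_d :=
  delta theta s a s' *: feature phi s a.

(** The conditional mean drift at [s], tested against [e]. Keeping [e] apart from [theta] lets the
    two arguments be perturbed one at a time. *)
Definition mean_dir e theta s : R :=
  step_mean pi P s (fun a s' => dotp e (td_dir theta s a s')).

Lemma rmax_ge0 : 0 <= rmax.
Proof. by have /andP[r0 r1] := rew_bounds s0 a0; exact: le_trans r1. Qed.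

Lemma M_ge1 : 1 <= M.
Proof. by have := rmax_ge0; move/andP: gamma_bounds => [? ?]; lra. Qed.

Lemma Qlin_sub theta theta' s a :
  Q theta s a - Q theta' s a = Q (theta - theta') s a.
Proof. by rewrite /Qlin dotpBr. Qed.

Lemma Qlin_le theta s a : `|Q theta s a| <= l2norm theta.
Proof.
apply: le_trans (normr_dotp_le _ _) _.
by rewrite -[leRHS]mul1r ler_wpM2r ?l2norm_ge0.
Qed.

Lemma Qmax_le theta s : `|Qmax theta s| <= l2norm theta.
Proof.
by have [a ->] := fmax_attained a0 (fun a => Q theta s a); exact: Qlin_le.
Qed.

Lemma Qmax_dist theta theta' s :
  `|Qmax theta s - Qmax theta' s| <= l2norm (theta - theta').
Proof.
have [a] := fmax_dist a0 (fun a => Q theta s a) (fun a => Q theta' s a).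
by move=> /le_trans; apply; rewrite Qlin_sub Qlin_le.
Qed.

Lemma sqr_Qmax_dist theta theta' s :
  (Qmax theta s - Qmax theta' s) ^+ 2
    <= fmax (fun a => Q (theta - theta') s a ^+ 2).
Proof.
have [a] := fmax_dist a0 (fun a => Q theta s a) (fun a => Q theta' s a).
rewrite Qlin_sub => le_Q; apply: le_trans (fmax_ge _ a).
by rewrite -real_normK ?num_real // -[leRHS]real_normK ?num_real // lerXn2r
  ?nnegrE.
Qed.

Lemma scaled_feature_le c s a : l2norm (c *: feature phi s a) <= `|c|.
Proof. by rewrite l2normZ -[leRHS]mulr1 ler_wpM2l. Qed.

Lemma td_dir_le theta s a s' :
  l2norm (td_dir theta s a s') <= M * (l2norm theta + 1).
Proof.
apply: le_trans (scaled_feature_le _ _ _) _; rewrite /td_error.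
have := Qmax_le theta s'; have := Qlin_le theta s a; have := l2norm_ge0 theta.
have /andP[r0 r1] := rew_bounds s a; have /andP[g0 g1] := gamma_bounds.
rewrite !ler_norml => t0 /andP[q1 q2] /andP[m1 m2]; apply/andP; split; nra.
Qed.

Lemma td_dir_lip theta theta' s a s' :
  l2norm (td_dir theta s a s' - td_dir theta' s a s')
    <= M * l2norm (theta - theta').
Proof.
rewrite -scalerBl; apply: le_trans (scaled_feature_le _ _ _) _;
  rewrite /td_error.
have := Qmax_dist theta theta' s'; have := Qlin_le (theta - theta') s a.
have := l2norm_ge0 (theta - theta'); rewrite -Qlin_sub.
have r0 := rmax_ge0; have /andP[g0 g1] := gamma_bounds.
rewrite !ler_norml => t0 /andP[q1 q2] /andP[m1 m2]; apply/andP; split; nra.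
Qed.

Lemma mean_dirBl e e' theta s :
  mean_dir (e - e') theta s = mean_dir e theta s - mean_dir e' theta s.
Proof.
rewrite -mulN1r -step_meanZ -step_meanD; apply: eq_bigr => a _.
by apply: eq_bigr => s' _; rewrite dotpBl mulN1r.
Qed.

Lemma mean_dir_le e theta s :
  `|mean_dir e theta s| <= l2norm e * (M * (l2norm theta + 1)).
Proof.
apply: normr_step_mean_le => // a s'; apply: le_trans (normr_dotp_le _ _) _.
by rewrite ler_wpM2l ?l2norm_ge0 ?td_dir_le.
Qed.

Lemma mean_dir_lip e theta theta' s :
  `|mean_dir e theta s - mean_dir e theta' s|
    <= l2norm e * (M * l2norm (theta - theta')).
Proof.
rewrite -mulN1r -step_meanZ -step_meanD; apply: normr_step_mean_le => // a s'.
rewrite mulN1r -dotpBr; apply: le_trans (normr_dotp_le _ _) _.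
by rewrite ler_wpM2l ?l2norm_ge0 ?td_dir_lip.
Qed.

Lemma step_sqr_norm_le theta thetas s c :
  step_mean pi P s
    (fun a s' => l2norm (theta + c *: td_dir theta s a s' - thetas) ^+ 2)
  <= l2norm (theta - thetas) ^+ 2 + 2 * c * mean_dir (theta - thetas) theta s
     + c ^+ 2 * (M * (l2norm theta + 1)) ^+ 2.
Proof.
have cst := step_mean_cst pi_distr P_stochastic s.
rewrite /mean_dir -step_meanZ -[X in _ <= X + _ + _]cst -[X in _ <= _ + X]cst.
rewrite -!step_meanD; apply: step_mean_le => // a s'.
rewrite (addrAC theta) (sqr_l2normD (theta - thetas)) dotpZr l2normZ.
rewrite exprMn real_normK ?num_real // mulrA lerD2l ler_wpM2l ?sqr_ge0 //.
by rewrite lerXn2r ?nnegrE ?l2norm_ge0 ?td_dir_le //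
  (le_trans _ (td_dir_le theta s a s')) ?l2norm_ge0.
Qed.

Variable theta0 : 'cV[R]_d.

Fixpoint traj_iter (step : nat -> R) k : traj S A k -> 'cV[R]_d :=
  if k is j.+1 return traj S A k -> 'cV[R]_d then
    fun h => traj_iter step h.1
      + step j *: td_dir (traj_iter step h.1) (traj_end h.1) h.2.1 h.2.2
  else fun=> theta0.

Lemma q_iter_traj (step : nat -> R) (s : nat -> S) (a : nat -> A) k :
  q_iter phi rew gamma theta0 step s a k = traj_iter step (traj_of s a k).
Proof.
by elim: k => [//|k IHk] /=; rewrite IHk traj_end_of /td_dir scalerA.
Qed.

(** * The stationary mean field and its drift *)

Variables (mu : S -> R) (thetas : 'cV[R]_d) (kappa : R).
Hypothesis mu_stationary : stationary (state_chain pi P) mu.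
Hypothesis Q2 : assumption_Q2 phi rew gamma pi P mu thetas kappa.

Definition stat_dir e theta : R := \sum_s mu s * mean_dir e theta s.

Lemma stat_mean_cst c : \sum_s mu s * c = c.
Proof. by rewrite -mulr_suml mu_stationary.1.2 mul1r. Qed.

Lemma stat_mean_next (g : S -> R) :
  \sum_s mu s * step_mean pi P s (fun _ s' => g s') = \sum_s mu s * g s.
Proof.
under eq_bigr do rewrite step_mean_state mulr_sumr.
rewrite exchange_big; apply: eq_bigr => s' _.
by rewrite -mu_stationary.2 mulr_suml; apply: eq_bigr => s _; rewrite mulrA.
Qed.

Lemma normr_stat_mean_le (f : S -> R) c : (forall s, `|f s| <= c) ->
  `|\sum_s mu s * f s| <= c.
Proof.
move=> fc; rewrite -(stat_mean_cst c); apply: le_trans (ler_norm_sum _ _ _) _.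
apply: ler_sum => s _; have mu0 := mu_stationary.1.1 s.
by rewrite normrM ger0_norm // ler_wpM2l.
Qed.

Lemma dotp_mean_update e theta :
  dotp e (mean_update phi rew gamma pi P mu theta) = stat_dir e theta.
Proof.
rewrite dotp_sumr; apply: eq_bigr => s _.
rewrite dotp_sumr mulr_sumr; apply: eq_bigr => a _.
rewrite dotp_sumr mulr_sumr; apply: eq_bigr => s' _.
by rewrite dotpZr !mulrA.
Qed.

Lemma stat_dir_thetas e : stat_dir e thetas = 0.
Proof.
have [hQ _ _] := Q2.
by rewrite -dotp_mean_update; have [_ ->] := hQ thetas; rewrite ?dotp0r.
Qed.

Lemma stat_dir_lip e theta theta' :
  `|stat_dir e theta - stat_dir e theta'|
    <= l2norm e * (M * l2norm (theta - theta')).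
Proof.
rewrite /stat_dir -sumrB; under eq_bigr do rewrite -mulrBr.
by apply: normr_stat_mean_le => s; exact: mean_dir_lip.
Qed.

Lemma stat_dir_le e theta :
  `|stat_dir e theta| <= l2norm e * (M * (l2norm theta + 1)).
Proof. by apply: normr_stat_mean_le => s; exact: mean_dir_le. Qed.

Lemma stat_dirBl e e' theta :
  stat_dir (e - e') theta = stat_dir e theta - stat_dir e' theta.
Proof.
by rewrite /stat_dir -sumrB; apply: eq_bigr => s _; rewrite mean_dirBl mulrBr.
Qed.

(* The cross term is split by [2 x y <= x^2 + y^2]; stationarity moves the
   maximum from S' back to S, where (Q2) applies. *)
Lemma stat_dir_drift theta :
  stat_dir (theta - thetas) theta
    <= - (kappa / 2) * l2norm (theta - thetas) ^+ 2.
Proof.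
have [_ _ /(_ (theta - thetas))] := Q2; set e := theta - thetas => drift.
rewrite -[stat_dir e theta]subr0 -(stat_dir_thetas e) /stat_dir -sumrB.
pose q s := step_mean pi P s (fun a _ => Q e s a ^+ 2).
pose m s := fmax (fun a => Q e s a ^+ 2).
have pointwise s : mu s * mean_dir e theta s - mu s * mean_dir e thetas s
    <= 2^-1 * (gamma ^+ 2 * (mu s * step_mean pi P s (fun _ s' => m s')) - mu s
      * q s).
  rewrite -mulrBr mulrCA -mulrBr mulrCA ler_wpM2l ?(mu_stationary.1.1 s) //.
  rewrite -mulN1r -[X in _ - X]mul1r -mulNr -!step_meanZ -!step_meanD
    -step_meanZ.
  apply: step_mean_le => // a s'; rewrite mulN1r -dotpBr -scalerBl dotpZr.
  have -> : dotp e (feature phi s a) = Q e s a by rewrite /Qlin dotpC.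
  have := sqr_Qmax_dist theta thetas s'; rewrite -/e -/(m s') /td_error.
  have := Qlin_sub theta thetas s a; rewrite -/e => <-.
  set x := Qmax theta s'; set y := Qmax thetas s'; set u := Q theta s a.
  set v := Q thetas s a => mxy.
  have := sqr_ge0 (gamma * (x - y) - (u - v)).
  have : gamma ^+ 2 * (x - y) ^+ 2 <= gamma ^+ 2 * m s'
      by rewrite ler_wpM2l ?sqr_ge0.
  by lra.
apply: le_trans (ler_sum _ (fun s _ => pointwise s)) _.
rewrite -mulr_sumr sumrB -mulr_sumr stat_mean_next.
have -> : \sum_s mu s * q s = \sum_s \sum_a mu s * pi s a * Q e s a ^+ 2.
  apply: eq_bigr => s _; rewrite /q step_mean_action // mulr_sumr.
  by apply: eq_bigr => a _; rewrite mulrA.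
by move: drift; rewrite -/m; lra.
Qed.

(** Test (Q2) on a unit vector: the maximum term is nonnegative, and the policy term is at most 1
    because the features have norm at most 1. *)
Lemma kappa_le1 : (0 < d)%N -> kappa <= 1.
Proof.
move=> d0; pose e : 'cV[R]_d := delta_mx (Ordinal d0) 0.
have [_ _ /(_ e)] := Q2; rewrite l2norm_delta expr1n mulr1.
have : 0 <= gamma ^+ 2 * \sum_s mu s * fmax (fun a => Q e s a ^+ 2).
  rewrite mulr_ge0 ?sqr_ge0 // sumr_ge0 // => s _.
  by rewrite mulr_ge0 ?(mu_stationary.1.1 s) // (le_trans _ (fmax_ge _ a0))
    ?sqr_ge0.
have : \sum_s \sum_a mu s * pi s a * Q e s a ^+ 2 <= 1.
  rewrite -[leRHS](stat_mean_cst 1); apply: ler_sum => s _.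
  under eq_bigr do rewrite -mulrA; rewrite -mulr_sumr.
  rewrite ler_wpM2l ?(mu_stationary.1.1 s) // -[leRHS](pi_distr s).2.
  apply: ler_sum => a _; rewrite ler_piMr ?(pi_distr s).1 //.
  by rewrite -real_normK ?num_real // exprn_ile1 // (le_trans (Qlin_le _ _ _))
    // l2norm_delta.
by lra.
Qed.

(** * The mean square error along paths *)

Variable mu0 : S -> R.
Hypothesis mu0_distr : is_distr mu0.

Local Notation err theta := (l2norm (theta - thetas)).
Local Notation b := (l2norm thetas + 1).
Local Notation E := (traj_mean pi P mu0).

Lemma norm_le_err theta : l2norm theta + 1 <= err theta + b.
Proof. by rewrite addrA lerD2r addrC l2norm_le_dist. Qed.

Lemma iter_err_step step k :
  E (fun h : traj S A k.+1 => err (traj_iter step h) ^+ 2)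
  <= E (fun h : traj S A k => err (traj_iter step h) ^+ 2
        + 2 * step k * mean_dir (traj_iter step h - thetas) (traj_iter step h)
          (traj_end h)
        + step k ^+ 2 * (M * (err (traj_iter step h) + b)) ^+ 2).
Proof.
rewrite traj_meanS.
apply: traj_mean_le => // h.
apply: le_trans
  (step_sqr_norm_le (traj_iter step h) thetas (traj_end h) (step k)) _.
have M0 : 0 <= M := le_trans ler01 M_ge1.
rewrite lerD2l ler_wpM2l ?sqr_ge0 // lerXn2r ?nnegrE ?ler_wpM2l ?norm_le_err //;
  by rewrite mulr_ge0 // ?addr_ge0 ?l2norm_ge0.
Qed.

(** * Constant step: Markovian noise over a mixing window *)

Section ConstantStep.
Variable alpha : R.
Hypothesis alpha_ge0 : 0 <= alpha.

Local Notation Theta := (traj_iter (fun=> alpha)).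

(** One step moves the iterate by at most [alpha M (|theta| + 1)]. While [alpha M t <= 1/2], the
    inductive bound keeps [|theta| + 1] below twice its value at the start of the window, whence the
    factor 2. *)
Lemma iter_window t k (h : traj S A (t + k)) : alpha * M * t%:R <= 1 / 2 ->
  l2norm (Theta h - Theta (traj_past h))
  <= 2 * (alpha * M * t%:R) * (l2norm (Theta (traj_past h)) + 1).
Proof.
elim: t h => [|t IHt] h tM.
  by rewrite subrr l2norm0 !mulr0 mul0r.
have M0 : 0 <= alpha * M by rewrite mulr_ge0 // (le_trans ler01 M_ge1).
have tM' : alpha * M * t%:R <= 1 / 2.
  by apply: le_trans tM; rewrite ler_wpM2l // ler_nat.
have := IHt h.1 tM';
    have /= := l2norm_le_dist (Theta h.1) (Theta (traj_past h.1)).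
have := td_dir_le (Theta h.1) (traj_end h.1) h.2.1 h.2.2.
set F := td_dir _ _ _ _; set y := Theta (traj_past h.1) => F1 n1 n2.
rewrite addrAC; apply: le_trans (l2normD_le _ _) _.
rewrite l2normZ ger0_norm //.
have := l2norm_ge0 y; have t0 : 0 <= t%:R :> R by [].
have aF : alpha * l2norm F <= alpha * M * (l2norm (Theta h.1) + 1).
  by rewrite -mulrA ler_wpM2l.
set c := alpha * M in M0 tM tM' n2 aF *; rewrite -(@natr1 _ t) in tM *.
move: n1 n2 aF; set x := l2norm (Theta h.1);
  set z := l2norm (_ - _) => n1 n2 aF y0.
have n3 : c * (x + 1) <= c * ((l2norm y + 1) * (1 + 2 * (c * t%:R))).
  by rewrite ler_wpM2l //; lra.
have n4 : c * (l2norm y + 1) * (2 * (c * t%:R)) <= c * (l2norm y + 1) * 1.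
  by apply: ler_wpM2l; [rewrite mulr_ge0 ?addr_ge0|lra].
by lra.
Qed.

Lemma mean_dir_window e theta e' theta' s :
  `|mean_dir e theta s - mean_dir e' theta' s|
  <= l2norm (e - e') * (M * (l2norm theta + 1))
     + l2norm e' * (M * l2norm (theta - theta')).
Proof.
rewrite -(subrKA (mean_dir e' theta s)) -mean_dirBl.
by apply: le_trans (ler_normD _ _) _; rewrite lerD ?mean_dir_le ?mean_dir_lip.
Qed.

Lemma stat_dir_window e theta e' theta' :
  `|stat_dir e theta - stat_dir e' theta'|
  <= l2norm (e - e') * (M * (l2norm theta + 1))
     + l2norm e' * (M * l2norm (theta - theta')).
Proof.
rewrite -(subrKA (stat_dir e' theta)) -stat_dirBl.
by apply: le_trans (ler_normD _ _) _; rewrite lerD ?stat_dir_le ?stat_dir_lip.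
Qed.

(** For frozen [e] and [theta] the sum is the integral of [mean_dir] against the signed measure
    [K - mu], whose l1 norm is at most [c]. Positive weight of [h] makes its last transition one to
    which the mixing hypothesis applies. *)
Lemma markov_bias_le t c j (h : traj S A j.+1) :
  (forall s a s', 0 < pi s a * P a s s' ->
     \sum_y `|kpow (state_chain pi P) t s' y - mu y| <= c) ->
  0 < traj_weight pi P mu0 h ->
  forall e theta,
  \sum_s kpow (state_chain pi P) t (traj_end h) s
           * (mean_dir e theta s - stat_dir e theta)
  <= c * (l2norm e * (M * (l2norm theta + 1))).
Proof.
move=> mix h0 e theta; set K := kpow _ _ _.
have -> : \sum_s K s * (mean_dir e theta s - stat_dir e theta)
    = \sum_s (K s - mu s) * mean_dir e theta s.
  under eq_bigr do rewrite mulrBr; under [RHS]eq_bigr do rewrite mulrBl.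
  rewrite !sumrB -mulr_suml sum_kpow ?mul1r //.
  exact: state_chain_stochastic.
apply: le_trans (ler_norm _) _; apply: le_trans (ler_norm_sum _ _ _) _.
set v := l2norm e * _.
have v0 : 0 <= v.
  have M0 : 0 <= M := le_trans ler01 M_ge1.
  by rewrite mulr_ge0 ?l2norm_ge0 // mulr_ge0 // addr_ge0 ?l2norm_ge0.
apply: le_trans (_ : \sum_s `|K s - mu s| * v <= _).
  by apply: ler_sum => s _; rewrite normrM ler_wpM2l ?mean_dir_le.
rewrite -mulr_suml ler_wpM2r // (mix (traj_end h.1) h.2.1) //.
rewrite lt0r step_weight_ge0 // andbT.
by apply: contraTneq h0 => /= ->; rewrite mulr0 ltxx.
Qed.

(* With [v = |theta - theta*| + |theta*| + 1] both [|theta| + 1] and the past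
   quantities are at most [2 v], which yields the constant [8 + 16 + 8 = 32]. *)
Lemma markov_noise_le t j :
  alpha * M * t%:R <= 1 / 260 ->
  (forall s a s', 0 < pi s a * P a s s' ->
     \sum_y `|kpow (state_chain pi P) t s' y - mu y| <= 2 * alpha) ->
  E (fun h : traj S A (t + j.+1) =>
       mean_dir (Theta h - thetas) (Theta h) (traj_end h)
       - stat_dir (Theta h - thetas) (Theta h))
  <= E (fun h : traj S A (t + j.+1) =>
          32 * (alpha * M ^+ 2 * t.+1%:R) * (err (Theta h) + b) ^+ 2).
Proof.
move=> tM mix; have M1 := M_ge1; have M0 : 0 <= M := le_trans ler01 M1.
have tM' : alpha * M * t%:R <= 1 / 2 by lra.
set tau := alpha * M * t%:R in tM.
have tau0 : 0 <= tau by rewrite !mulr_ge0.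
(* The iterate is frozen at the start of the window and only the state moves on, so that
   [traj_mean_markov] applies. *)
pose bias (h : traj S A j.+1) s :=
  mean_dir (Theta h - thetas) (Theta h) s
    - stat_dir (Theta h - thetas) (Theta h).
pose v (h : traj S A (t + j.+1)) := err (Theta h) + b.
have bnd (h : traj S A (t + j.+1)) : let y := Theta (traj_past h) in
    [/\ l2norm (Theta h - y) <= 4 * tau * v h, err y <= 2 * v h,
        l2norm y + 1 <= 2 * v h & l2norm (Theta h) + 1 <= v h].
  move=> y; have := iter_window h tM'; rewrite -/tau -/y.
  have := norm_le_err (Theta h); rewrite -/(v h).
  have := l2norm_le_dist y (Theta h).
  have := l2norm_le_dist (y - thetas) (Theta h - thetas).
  have := l2norm_ge0 thetas; have := l2norm_ge0 (Theta h); have := l2norm_ge0 y.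
  rewrite opprB addrA subrK (l2norm_distC y (Theta h)) /v.
  set D := l2norm (Theta h - y); set n := l2norm (Theta h); set m := l2norm y.
  set u := err (Theta h) + b => m0 n0 b0 e1 e2 e3 e4.
  (* [D] occurs on both sides because the start of the window is itself compared with its end; the
     smallness of [tau] absorbs it. *)
  have D1 : D <= 2 * tau * (u + D).
    by apply: le_trans e4 _; apply: ler_wpM2l; [rewrite mulr_ge0|lra].
  have D2 : tau * D <= 1 / 260 * D by rewrite ler_wpM2r ?l2norm_ge0.
  have u0 : 0 <= u by rewrite /u !addr_ge0 ?l2norm_ge0.
  have D3 : tau * u <= 1 / 260 * u by rewrite ler_wpM2r.
  have tu0 : 0 <= tau * u by rewrite mulr_ge0.
  have eu : err (Theta h) <= u by rewrite lerDl addr_ge0.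
  by split; lra.
have split_le (h : traj S A (t + j.+1)) :
    mean_dir (Theta h - thetas) (Theta h) (traj_end h)
      - stat_dir (Theta h - thetas) (Theta h)
    <= bias (traj_past h) (traj_end h) + 24 * (tau * M) * v h ^+ 2.
  have [d1 d2 d3 d4] := bnd h; rewrite /bias.
  set y := Theta (traj_past h) in d1 d2 d3 *.
  have := mean_dir_window (Theta h - thetas) (Theta h) (y - thetas) y
      (traj_end h).
  have := stat_dir_window (Theta h - thetas) (Theta h) (y - thetas) y.
  rewrite opprB addrA subrK; set D := l2norm (Theta h - y).
  have le1 : D * (M * (l2norm (Theta h) + 1)) <= 4 * tau * v h * (M * v h).
    by apply: ler_pM (l2norm_ge0 _) _ d1 (ler_wpM2l M0 d4);
      rewrite mulr_ge0 // addr_ge0 ?l2norm_ge0.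
  have le2 : err y * (M * D) <= 2 * v h * (M * (4 * tau * v h)).
    apply: ler_pM (l2norm_ge0 _) _ d2 (ler_wpM2l M0 d1).
    by rewrite mulr_ge0 // l2norm_ge0.
  by rewrite !ler_norml => /andP[s1 s2] /andP[m1 m2]; lra.
apply: le_trans (traj_mean_le pi_distr P_stochastic mu0_distr split_le) _.
rewrite traj_meanD (traj_mean_markov pi P mu0 t bias).
pose c (h : traj S A j.+1) :=
  2 * alpha * (err (Theta h) * (M * (l2norm (Theta h) + 1))).
have bias_le : E (fun h : traj S A j.+1 =>
    \sum_s kpow (state_chain pi P) t (traj_end h) s * bias h s) <= E c.
  apply: traj_mean_le_supp => // h h0; exact: markov_bias_le.
apply: le_trans (lerD bias_le (lexx _)) _.
rewrite -(traj_mean_past pi_distr P_stochastic mu0 t c) -traj_meanD.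
apply: traj_mean_le => // h; rewrite /c.
have [_ d2 d3 _] := bnd h; set y := Theta (traj_past h) in d2 d3 *.
have c_le : err y * (M * (l2norm y + 1)) <= 2 * v h * (M * (2 * v h)).
  by apply: ler_pM (l2norm_ge0 _) _ d2 (ler_wpM2l M0 d3);
    rewrite mulr_ge0 // addr_ge0 ?l2norm_ge0.
rewrite -/(v h) -(@natr1 _ t).
have c_le2 : 2 * alpha * (err y * (M * (l2norm y + 1)))
    <= 2 * alpha * (2 * v h * (M * (2 * v h))) by rewrite ler_wpM2l ?mulr_ge0.
have tauM : 0 <= tau * M by rewrite mulr_ge0.
have M3 : 0 <= alpha * M * v h ^+ 2 by apply: mulr_ge0 (sqr_ge0 _);
    exact: mulr_ge0.
have M2 : alpha * M * v h ^+ 2 <= alpha * M * v h ^+ 2 * M.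
  by apply: ler_peMr M1.
have tauM2 : 0 <= tau * M * v h ^+ 2 by apply: mulr_ge0 (sqr_ge0 _).
by rewrite /tau in tauM2 *; lra.
Qed.

(** Here [t.+1] plays the mixing time. The noise, with constant [2 * 32], and the second-order term,
    with constant 1, add up to [65 alpha^2 M^2 (t + 1) E v^2], and [v^2 <= 2 err^2 + 2 b^2] doubles
    65 to 130. By the step condition the [err^2] part costs at most half of the drift
    [kappa * alpha]. *)
Lemma const_step_recursion t k : (t < k)%N ->
  alpha * M ^+ 2 * t.+1%:R <= kappa / 260 -> kappa <= 1 ->
  (forall s a s', 0 < pi s a * P a s s' ->
     \sum_y `|kpow (state_chain pi P) t s' y - mu y| <= 2 * alpha) ->
  E (fun h : traj S A k.+1 => err (Theta h) ^+ 2)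
  <= (1 - kappa * alpha / 2) * E (fun h : traj S A k => err (Theta h) ^+ 2)
     + 130 * M ^+ 2 * b ^+ 2 * alpha ^+ 2 * t.+1%:R.
Proof.
move=> tk tM kappa1 mix; have M1 := M_ge1;
  have M0 : 0 <= M := le_trans ler01 M1.
have tM' : alpha * M * t%:R <= 1 / 260.
  apply: le_trans (_ : alpha * M ^+ 2 * t.+1%:R <= _); last by lra.
  rewrite ler_pM ?ler_nat ?mulr_ge0 // ler_wpM2l // expr2 ler_peMr //.
have noise := markov_noise_le (k - t.+1) tM' mix.
rewrite (_ : (t + (k - t.+1).+1 = k)%N) in noise;
  last by rewrite -subSn // subSS subnKC // ltnW.
apply: le_trans (iter_err_step _ _) _.
pose x h := err (Theta (k:=k) h) ^+ 2.
pose v (h : traj S A k) := err (Theta h) + b.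
pose f (h : traj S A k) := mean_dir (Theta h - thetas) (Theta h) (traj_end h).
pose g (h : traj S A k) := stat_dir (Theta h - thetas) (Theta h).
pose C := alpha ^+ 2 * M ^+ 2 * t.+1%:R.
apply: le_trans
  (_ : E (fun h => (1 - kappa * alpha) * x h + 2 * alpha * (f h - g h)
    + alpha ^+ 2 * M ^+ 2 * v h ^+ 2) <= _).
  apply: traj_mean_le => // h; have := stat_dir_drift (Theta h).
  rewrite -/(x h) -/(v h) -/(f h) -/(g h) exprMn => drift.
  have := ler_wpM2l (mulr_ge0 (ler0n R 2) alpha_ge0) drift; lra.
rewrite !traj_meanD !traj_meanZ.
have := ler_wpM2l (mulr_ge0 (ler0n R 2) alpha_ge0) noise.
rewrite -/f -/g traj_meanZ -/v => noise'.
have v2 : E (fun h => v h ^+ 2) <= 2 * E x + 2 * b ^+ 2.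
  rewrite -traj_meanZ
    -(traj_mean_cst pi_distr P_stochastic mu0_distr k (2 * b ^+ 2)).
  rewrite -traj_meanD; apply: traj_mean_le => // h; rewrite /v /x.
  have := sqr_ge0 (err (Theta h) - b); lra.
have t1 : 1 <= t.+1%:R :> R by rewrite ler1n.
have v20 : 0 <= E (fun h => v h ^+ 2) by apply: traj_mean_ge0 => // h;
    exact: sqr_ge0.
have C0 : 0 <= alpha ^+ 2 * M ^+ 2 by rewrite mulr_ge0 ?sqr_ge0.
have Cv : alpha ^+ 2 * M ^+ 2 * E (fun h => v h ^+ 2)
    <= alpha ^+ 2 * M ^+ 2 * E (fun h => v h ^+ 2) * t.+1%:R.
  by rewrite ler_peMr // mulr_ge0.
have Cx : 65 * C * E (fun h => v h ^+ 2) <= 65 * C * (2 * E x + 2 * b ^+ 2).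
  by rewrite ler_wpM2l // !mulr_ge0 // ?sqr_ge0.
have x0 : 0 <= E x by apply: traj_mean_ge0 => // h; exact: sqr_ge0.
have kx : 130 * alpha * (alpha * M ^+ 2 * t.+1%:R) * E x
    <= 130 * alpha * (kappa / 260) * E x.
  by rewrite ler_wpM2r // ler_wpM2l ?mulr_ge0.
rewrite -[fun h => err (Theta h) ^+ 2]/x.
rewrite /C in Cx; lra.
Qed.

End ConstantStep.

(** * Constant step: iterating the recursion *)

(** The additive term is the fixed point of the recursion, since [kappa * alpha / 2] times it equals
    the noise [eta2 * alpha ^+ 2 * t.+1]. The induction starts at time [t.+1], when the iterate has
    moved from [theta0] by at most [|theta0| + 1]; this explains [eta1]. *)
Lemma const_step_bound alpha t n : 0 <= alpha < 1 -> kappa <= 1 ->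
  0 < kappa ->
  alpha * M ^+ 2 * t.+1%:R <= kappa / 260 ->
  (forall s a s', 0 < pi s a * P a s s' ->
     \sum_y `|kpow (state_chain pi P) t s' y - mu y| <= 2 * alpha) ->
  E (fun h : traj S A (t.+1 + n) => err (traj_iter (fun=> alpha) h) ^+ 2)
  <= (l2norm theta0 + err theta0 + 1) ^+ 2 * (1 - kappa * alpha / 2) ^+ n
     + 2 * (130 * M ^+ 2 * b ^+ 2) * alpha * t.+1%:R / kappa.
Proof.
move=> /andP[alpha0 alpha1] kappa1 kappa0 tM mix.
have M1 := M_ge1; have M0 : 0 <= M := le_trans ler01 M1.
have ka1 : 0 <= 1 - kappa * alpha / 2.
  have : kappa * alpha <= 1 * 1 by rewrite ler_pM // ltW.
  by lra.
set eta1 := (_ + 1) ^+ 2; set eta2 := 130 * _ * _.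
have floor0 : 0 <= 2 * eta2 * alpha * t.+1%:R / kappa.
  have eta20 : 0 <= eta2 by rewrite mulr_ge0 ?sqr_ge0 // mulr_ge0 ?sqr_ge0.
  by apply: divr_ge0 (ltW kappa0); do 3![apply: mulr_ge0 => //].
elim: n => [|n IHn]; last first.
  rewrite addnS;
    apply: le_trans (const_step_recursion alpha0 _ tM kappa1 mix) _.
    by rewrite addSn ltnS leq_addr.
  have := ler_wpM2l ka1 IHn; rewrite (exprS _ n) -/eta2.
  set c := t.+1%:R; set X := E _; set Y := (1 - _) ^+ n => {}IHn.
  have e : kappa * alpha / 2 * (2 * eta2 * alpha * c / kappa)
      = eta2 * alpha ^+ 2 * c.
    by field; rewrite gt_eqF.
  move: e IHn; set fl := _ / kappa; set q := 1 - _ => e IHn.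
  have qfl : q * fl = fl - eta2 * alpha ^+ 2 * c by rewrite /q mulrBl mul1r e.
  by lra.
apply: (@le_trans _ _ eta1); last by rewrite expr0 mulr1 lerDl.
rewrite -(traj_mean_cst pi_distr P_stochastic mu0_distr (t.+1 + 0) eta1).
apply: traj_mean_le => // h.
have tM' : alpha * M * t.+1%:R <= 1 / 2.
  apply: le_trans (_ : alpha * M ^+ 2 * t.+1%:R <= _); last by lra.
  by rewrite ler_wpM2r // ler_wpM2l // expr2 ler_peMr.
have past0 (i : nat) (g : traj S A (i + 0)) :
    traj_iter (fun=> alpha) (traj_past g) = theta0.
  by [].
have := iter_window alpha0 h tM'; rewrite past0 => le_move.
have := l2norm_le_dist (traj_iter (fun=> alpha) h - thetas) (theta0 - thetas).
rewrite opprB addrA subrK => le_err.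
have n0 : 0 <= l2norm theta0 + 1 by rewrite addr_ge0 ?l2norm_ge0.
have half := ler_wpM2r n0 tM'.
rewrite /eta1 lerXn2r ?nnegrE ?addr_ge0 ?l2norm_ge0 //.
by move: le_move le_err half; lra.
Qed.

(** * Diminishing steps: the noise as a telescoping sum *)

(** For a frozen iterate, [V] solves the Poisson equation, so the noise at time [k] is [D k - N k],
    with [N k] the mean of [V] at the next state and the old iterate. Passing from [N k] to [D k.+1]
    changes only the iterate, an error of order [step k], hence of second order once multiplied by
    the step. [C] is chosen before the step sequence. *)
Lemma correctable_recursion (Z : S -> S -> R) :
  (forall s y, Z s y - \sum_z state_chain pi P s z * Z z y
               = (s == y)%:R - mu y) ->
  exists2 C : R, 0 <= C &
  forall step : nat -> R, (forall k, 0 <= step k <= 1) ->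
    let x k := E (fun h : traj S A k => err (traj_iter step h) ^+ 2) in
    exists D : nat -> R, forall k,
      [/\ `|D k| <= C * (1 + x k), x k.+1 <= C * (1 + x k) &
          x k.+1 <= (1 - kappa * step k) * x k + 2 * step k * (D k - D k.+1)
                    + C * step k ^+ 2 * (1 + x k)].
Proof.
move=> poisson; have M1 := M_ge1; have M0 : 0 <= M := le_trans ler01 M1.
pose z := \sum_s \sum_y `|Z s y|.
have z_row s : \sum_y `|Z s y| <= z.
  by rewrite [leRHS](bigD1 s) //= lerDl; apply: sumr_ge0 => u _;
    apply: sumr_ge0.
have z0 : 0 <= z by apply: sumr_ge0 => u _; apply: sumr_ge0.
pose V e theta s := \sum_y Z s y * mean_dir e theta y.
have V_eq e theta s : V e theta s - \sum_u state_chain pi P s u * V e theta u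
    = mean_dir e theta s - stat_dir e theta.
  have -> : \sum_u state_chain pi P s u * V e theta u
      = \sum_y (\sum_u state_chain pi P s u * Z u y) * mean_dir e theta y.
    under [RHS]eq_bigr do rewrite mulr_suml.
    rewrite exchange_big; apply: eq_bigr => u _; rewrite mulr_sumr.
    by apply: eq_bigr => y _; rewrite mulrA.
  rewrite -sumrB; under eq_bigr do rewrite -mulrBl poisson mulrBl.
  by rewrite sumrB (kpow0_mean (state_chain pi P)).
have V_bound (f : S -> R) s c : (forall y, `|f y| <= c) ->
    `|\sum_y Z s y * f y| <= z * c.
  move=> fc; have c0 : 0 <= c := le_trans (normr_ge0 _) (fc s0).
  apply: le_trans (ler_norm_sum _ _ _) _.
  apply: (@le_trans _ _ (\sum_y `|Z s y| * c)).
    by apply: ler_sum => y _; rewrite normrM ler_wpM2l.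
  by rewrite -mulr_suml ler_wpM2r.
pose v theta := err theta + b.
have v0 theta : 0 <= v theta by rewrite /v !addr_ge0 ?l2norm_ge0.
have err_v theta : err theta <= v theta
    by rewrite /v lerDl addr_ge0 ?l2norm_ge0.
have V_le theta s : `|V (theta - thetas) theta s| <= z * M * v theta ^+ 2.
  rewrite expr2 -mulrA (mulrA M) (mulrC M) -mulrA.
  apply: V_bound => y; apply: le_trans (mean_dir_le _ _ _) _.
  by apply: ler_pM; rewrite ?l2norm_ge0 ?ler_wpM2l ?norm_le_err //
    mulr_ge0 // addr_ge0 ?l2norm_ge0.
have move_le theta s a s' c : 0 <= c <= 1 ->
    let theta' := theta + c *: td_dir theta s a s' in
    [/\ l2norm (theta' - theta) <= c * (M * v theta),
        v theta' <= (1 + M) * v theta &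
        `|V (theta' - thetas) theta' s' - V (theta - thetas) theta s'|
        <= c * (z * M ^+ 2 * (2 + M)) * v theta ^+ 2].
  move=> /andP[c0 c1] theta'.
  have F_le : l2norm (td_dir theta s a s') <= M * v theta.
    by apply: le_trans (td_dir_le _ _ _ _) _; rewrite ler_wpM2l ?norm_le_err.
  have move1 : l2norm (theta' - theta) <= c * (M * v theta).
    by rewrite /theta' addrAC subrr add0r l2normZ ger0_norm // ler_wpM2l.
  have cM : c * (M * v theta) <= M * v theta by rewrite ler_piMl // mulr_ge0.
  have move2 : v theta' <= (1 + M) * v theta.
    have := l2norm_le_dist (theta' - thetas) (theta - thetas).
    by rewrite opprB addrA subrK /v in cM move1 *; lra.
  split => //; rewrite /V -sumrB; under eq_bigr do rewrite -mulrBr.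
  have -> : c * (z * M ^+ 2 * (2 + M)) * v theta ^+ 2
      = z * (c * (M * v theta) * (M * ((1 + M) * v theta))
             + v theta * (M * (c * (M * v theta)))) by ring.
  apply: V_bound => y; apply: le_trans (mean_dir_window _ _ _ _ _) _.
  rewrite opprB addrA subrK; apply: lerD; apply: ler_pM; rewrite ?l2norm_ge0 //.
  - by rewrite mulr_ge0 // addr_ge0 ?l2norm_ge0.
  - by rewrite ler_wpM2l // (le_trans (norm_le_err _)).
  - by rewrite mulr_ge0 ?l2norm_ge0.
  - by rewrite ler_wpM2l.
have b1 : 1 <= b ^+ 2 by rewrite exprn_ege1 // lerDr l2norm_ge0.
(* The sum of the constants of the three required bounds. In the witness below it is multiplied by
   [2 * b ^+ 2], since [b >= 1] gives [v^2 <= 2 b^2 (1 + err^2)]. *)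
pose c1 := z * M + (1 + M) ^+ 2 + (2 * (z * M ^+ 2 * (2 + M)) + M ^+ 2).
have zM0 : 0 <= z * M by rewrite mulr_ge0.
have M20 : 0 <= (1 + M) ^+ 2 by exact: sqr_ge0.
have c20 : 0 <= z * M ^+ 2 * (2 + M).
  by apply: mulr_ge0; [apply: mulr_ge0 => //; exact: sqr_ge0|rewrite addr_ge0].
have MM0 : 0 <= M ^+ 2 by exact: sqr_ge0.
exists (c1 * (2 * b ^+ 2)).
  by apply: mulr_ge0; [rewrite /c1; lra|rewrite mulr_ge0 ?sqr_ge0].
move=> step step01 x.
pose D k := E (fun h : traj S A k =>
  V (traj_iter step h - thetas) (traj_iter step h) (traj_end h)).
pose w k := E (fun h : traj S A k => v (traj_iter step h) ^+ 2).
exists D => k; have /andP[st0 st1] := step01 k.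
have w0 : 0 <= w k by apply: traj_mean_ge0 => // h; exact: sqr_ge0.
have wx : w k <= 2 * b ^+ 2 * (1 + x k).
  rewrite -[X in _ <= _ * (X + _)]
    (traj_mean_cst pi_distr P_stochastic mu0_distr k).
  rewrite -traj_meanD -traj_meanZ.
  apply: traj_mean_le => // h; rewrite /v; set u := err _.
  have := sqr_ge0 (u - b); have := ler_wpM2r (sqr_ge0 u) b1; lra.
have C_le c : 0 <= c -> c <= c1 -> c * w k <= c1 * (2 * b ^+ 2) * (1 + x k).
  by move=> c0 cc; rewrite -mulrA ler_pM.
split.
- apply: le_trans (C_le (z * M) zM0 _); last by rewrite /c1; lra.
  rewrite -traj_meanZ ler_norml -mulN1r -traj_meanZ.
  by apply/andP; split; apply: traj_mean_le => // h;
    have := V_le (traj_iter step h) (traj_end h);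
    rewrite ler_norml => /andP[]; lra.
- apply: le_trans (C_le ((1 + M) ^+ 2) M20 _); last by rewrite /c1; lra.
  rewrite /x traj_meanS -traj_meanZ; apply: traj_mean_le => // h.
  rewrite -(step_mean_cst pi_distr P_stochastic (traj_end h) (_ * _)).
  apply: step_mean_le => // a s' /=.
  have [_ le_v _] :=
      move_le (traj_iter step h) (traj_end h) a s' (step k) (step01 k).
  have le_err := le_trans (err_v _) le_v.
  by rewrite -exprMn lerXn2r ?nnegrE ?l2norm_ge0 //
    (le_trans (l2norm_ge0 _) le_err).
pose N k := E (fun h : traj S A k =>
  \sum_u state_chain pi P (traj_end h) u
    * V (traj_iter step h - thetas) (traj_iter step h) u).
have next_le : D k.+1 <= N k + step k * (z * M ^+ 2 * (2 + M)) * w k.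
  rewrite /D traj_meanS -traj_meanZ -traj_meanD; apply: traj_mean_le => // h.
  rewrite -step_mean_state
    -(step_mean_cst pi_distr P_stochastic (traj_end h) (_ * _)).
  rewrite -step_meanD; apply: step_mean_le => // a s' /=.
  have [_ _] := move_le (traj_iter step h) (traj_end h) a s' (step k)
      (step01 k).
  by rewrite ler_norml => /andP[_]; rewrite lerBlDl.
have DN : D k - N k = E (fun h : traj S A k =>
    mean_dir (traj_iter step h - thetas) (traj_iter step h) (traj_end h)
    - stat_dir (traj_iter step h - thetas) (traj_iter step h)).
  rewrite -mulN1r -traj_meanZ -traj_meanD; apply: eq_traj_mean => h.
  by rewrite mulN1r V_eq.
have drift : x k.+1 <= (1 - kappa * step k) * x k + 2 * step k * (D k - N k)
    + step k ^+ 2 * M ^+ 2 * w k.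
  apply: le_trans (iter_err_step _ _) _;
    rewrite DN /x /w -!traj_meanZ -!traj_meanD.
  apply: traj_mean_le => // h; rewrite -/(v _) exprMn.
  have := stat_dir_drift (traj_iter step h).
  by move=> /(ler_wpM2l (mulr_ge0 (ler0n R 2) st0)); lra.
pose c3 := 2 * (z * M ^+ 2 * (2 + M)) + M ^+ 2.
have c3w : c3 * w k <= c1 * (2 * b ^+ 2) * (1 + x k).
  by apply: C_le; rewrite /c1 /c3; lra.
have := ler_wpM2l (sqr_ge0 (step k)) c3w.
have := ler_wpM2l (mulr_ge0 (ler0n R 2) st0) next_le.
by move: drift; rewrite /c3; lra.
Qed.

(** * The degenerate case of a single state and action *)

(** The mean update is now the update itself, so it vanishes at [thetas], and the maximum is linear:
    the direction is [- (1 - gamma) q] times the feature, with [q] the value of the error. As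
    [alpha (1 - gamma) <= 1], the quadratic term cancels at most half of the linear gain
    [2 alpha (1 - gamma) q^2]; the drift bound turns the rest into the factor
    [1 - kappa alpha / 2]. *)
Lemma single_transition_contraction alpha k (h : traj S A k) :
  (forall s, s = s0) -> (forall a, a = a0) -> 0 <= alpha <= 1 -> kappa <= 1 ->
  err (traj_iter (fun=> alpha) h) ^+ 2
  <= (1 - kappa * alpha / 2) ^+ k * err theta0 ^+ 2.
Proof.
move=> hS hA /andP[alpha0 alpha1] kappa1.
have [g0 g1] := andP gamma_bounds.
have Qmax1 theta s : Qmax theta s = Q theta s0 a0.
  by have [a ->] := fmax_attained a0 (fun a => Q theta s a);
    rewrite (hA a) (hS s).
have mean_dir1 e theta s : mean_dir e theta s = dotp e (td_dir theta s0 a0 s0).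
  rewrite -[RHS](step_mean_cst pi_distr P_stochastic s).
  by apply: eq_bigr => a _; apply: eq_bigr => s' _;
    rewrite (hS s) (hA a) (hS s').
have stat_dir1 e theta : stat_dir e theta = dotp e (td_dir theta s0 a0 s0).
  rewrite -[RHS]stat_mean_cst.
  by apply: eq_bigr => s _; rewrite mean_dir1.
have td_thetas : td_dir thetas s0 a0 s0 = 0.
  apply: l2norm_eq0; apply/eqP; rewrite -sqrf_eq0 sqr_l2norm -stat_dir1.
  by rewrite stat_dir_thetas.
have td1 theta : td_dir theta s0 a0 s0
    = (- (1 - gamma) * Q (theta - thetas) s0 a0) *: feature phi s0 a0.
  rewrite -[LHS]subr0 -td_thetas -scalerBl /td_error !Qmax1 -Qlin_sub.
  by congr (_ *: _); ring.
have ka : kappa * alpha <= 2.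
  by have := ler_wpM2r alpha0 kappa1; lra.
have step_le theta : err (theta + alpha *: td_dir theta s0 a0 s0) ^+ 2
    <= (1 - kappa * alpha / 2) * err theta ^+ 2.
  have := stat_dir_drift theta; rewrite stat_dir1 td1.
  rewrite (addrAC theta) (sqr_l2normD (theta - thetas)) !dotpZr !l2normZ.
  have -> : dotp (theta - thetas) (feature phi s0 a0)
      = Q (theta - thetas) s0 a0.
    by rewrite dotpC.
  set q := Q _ s0 a0; set u := l2norm (feature _ _ _) => drift.
  have u2 : u ^+ 2 <= 1 by rewrite exprn_ile1 ?l2norm_ge0 ?phi_norm.
  rewrite !exprMn !real_normK ?num_real // exprMn sqrrN.
  have c0 : 0 <= alpha ^+ 2 * ((1 - gamma) ^+ 2 * q ^+ 2).
    by apply: mulr_ge0 (sqr_ge0 _) _; apply: mulr_ge0; exact: sqr_ge0.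
  have := ler_wpM2l c0 u2.
  have q0 : 0 <= alpha * ((1 - gamma) * q ^+ 2).
    by apply: mulr_ge0 => //; apply: mulr_ge0 (sqr_ge0 _); lra.
  have a1 : alpha * (1 - gamma) <= 1 by apply: mulr_ile1 => //; lra.
  have := ler_wpM2r q0 a1; have := ler_wpM2l alpha0 drift; lra.
elim: k h => [|k IHk] h; first by rewrite expr0 mul1r.
case: h => h [a s'] /=; rewrite (hS (traj_end h)) (hA a) (hS s').
apply: le_trans (step_le _) _.
by rewrite (exprS _ k) -(mulrA (1 - _)); apply: ler_wpM2l => //; lra.
Qed.

End QLearning.

(** * Geometric decay and mixing times *)

Lemma geometric_small (R : realType) (c rho eps : R) :
  0 < rho < 1 -> 0 < eps -> exists k, c * rho ^+ k <= eps.
Proof.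
move=> /andP[rho0 rho1] eps0.
have /(cvg_geometric c)/cvgrPdist_lt/(_ _ eps0)[N _ /(_ N (leqnn N))] :
    `|rho| < 1.
  by rewrite ger0_norm // ltW.
rewrite sub0r normrN => /ltW; exists N; exact: le_trans (ler_norm _) _.
Qed.

Lemma mixing_time_le (R : realType) (T : finType) (K : T -> T -> R) mu delta :
  (exists k, max_tv K mu k <= delta) ->
  max_tv K mu (mixing_time K mu delta) <= delta.
Proof.
move=> ex_k; rewrite /mixing_time; set P := [set t | _].
suff /(xgetPex 0%N) [] : exists t, P t by [].
by have [t le_t min_t] := ex_minnP ex_k; exists t; split.
Qed.

Lemma tv_le_max_tv (R : realType) (T : finType) (K : T -> T -> R) mu k x :
  tv_dist (kpow K k x) mu <= max_tv K mu k.
Proof. exact: (fmax_ge (fun x => tv_dist (kpow K k x) mu)). Qed.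

(** * Comparing the chain of transitions with the chain of states *)

Section TransitionChain.
Variables (R : realType) (S A : finType).
Variables (pi : S -> A -> R) (P : A -> S -> S -> R) (mu : S -> R).
Hypothesis pi_distr : forall s, is_distr (pi s).
Hypothesis P_stochastic : forall a, stochastic (P a).

Local Notation X := (transition_space pi P).
Local Notation weight y :=
  (pi (val y).1.1 (val y).1.2 * P (val y).1.2 (val y).1.1 (val y).2).

Lemma step_weight_gt0 s a s' :
  ((0 < pi s a) && (0 < P a s s')) = (0 < pi s a * P a s s').
Proof.
have pi0 := (pi_distr s).1 a; have P0 := (P_stochastic a s).1 s'.
by rewrite !lt0r mulf_eq0 negb_or pi0 P0 mulr_ge0 // !andbT.
Qed.

(** Triples outside the transition space have weight zero, so the sum may run over all triples. *)
Lemma sum_transition_space (g : S -> A -> S -> R) :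
  \sum_(y : X) weight y * g (val y).1.1 (val y).1.2 (val y).2
  = \sum_s step_mean pi P s (g s).
Proof.
transitivity (\sum_(y : S * A * S) pi y.1.1 y.1.2 * P y.1.2 y.1.1 y.2
  * g y.1.1 y.1.2 y.2).
  rewrite [RHS](bigID
    (fun y => (0 < pi y.1.1 y.1.2) && (0 < P y.1.2 y.1.1 y.2))) /=.
  rewrite [X in _ = _ + X]big1 ?addr0 => [|y]; last first.
    rewrite step_weight_gt0 lt0r step_weight_ge0 // andbT negbK => /eqP ->.
    by rewrite mul0r.
  rewrite [RHS](reindex_omap (val : X -> _) insub) => [|y yX];
    last by rewrite insubT.
  by apply: eq_bigl => y; rewrite (valP y) valK eqxx.
rewrite /step_mean pair_bigA /= pair_bigA /=.
by apply: eq_bigr => -[[s a] s'].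
Qed.

(** A transition influences the future only through its end state: the state chain takes [k] steps
    from there to the source of [y], and the last step draws [y]. Hence the shift by one. *)
Lemma kpow_transition_chain k (x y : X) :
  kpow (@transition_chain R S A pi P) k.+1 x y
  = kpow (state_chain pi P) k (val x).2 (val y).1.1 * weight y.
Proof.
have chainE (u v : X) :
    transition_chain u v = ((val u).2 == (val v).1.1)%:R * weight v.
  by case: v => -[[s a] s1] v_pos; rewrite /transition_chain /= eq_sym mulrA.
elim: k x => [|k IHk] x.
  by rewrite kpowSr kpow0_mean chainE.
transitivity (\sum_z transition_chain x z
  * kpow (@transition_chain R S A pi P) k.+1 z y) => //.
under eq_bigr do rewrite IHk chainE.
transitivity (\sum_(z : X) weight z * (((val x).2 == (val z).1.1)%:R
   * (kpow (state_chain pi P) k (val z).2 (val y).1.1 * weight y))).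
  by apply: eq_bigr => z _; ring.
rewrite (sum_transition_space (fun s a s' => ((val x).2 == s)%:R *
  (kpow (state_chain pi P) k s' (val y).1.1 * weight y))).
under eq_bigr do rewrite step_meanZ step_mean_state.
rewrite (kpow0_mean (state_chain pi P)) /= mulr_suml.
by apply: eq_bigr => z _; rewrite mulrA.
Qed.

(** Both laws carry the factor [weight y], which sums to 1 over actions and next states. *)
Lemma transition_dist_state_dist k (x : X) :
  \sum_y `|kpow (@transition_chain R S A pi P) k.+1 x y - transition_distr mu y|
  = \sum_s `|kpow (state_chain pi P) k (val x).2 s - mu s|.
Proof.
transitivity (\sum_(y : X) weight y
  * `|kpow (state_chain pi P) k (val x).2 (val y).1.1 - mu (val y).1.1|).
  apply: eq_bigr => y _; rewrite kpow_transition_chain.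
  have -> : transition_distr mu y = mu (val y).1.1 * weight y.
    by case: y => -[[s a] s1] y_pos; rewrite /transition_distr /= mulrA.
  rewrite -mulrBl normrM mulrC ger0_norm // step_weight_ge0 //.
rewrite (sum_transition_space
  (fun s a s' => `|kpow (state_chain pi P) k (val x).2 s - mu s|)).
by apply: eq_bigr => s _; rewrite step_mean_cst.
Qed.

(** The factor 2, lost between total variation and l1, is harmless: the bound only serves to show
    that every positive level is reached, so that the mixing time is a genuine minimum. *)
Lemma max_tv_transition_le k c :
  0 <= c -> max_tv (state_chain pi P) mu k <= c ->
  max_tv (@transition_chain R S A pi P) (transition_distr mu) k.+1 <= 2 * c.
Proof.
move=> c0 tv_c; have [x _|X0] := pickP X; last first.
  rewrite /max_tv /fmax; case: pickP => [x|_]; last by rewrite mulr_ge0.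
  by have := X0 x.
apply: (fmax_le x) => y; apply: le_trans (tv_le_sum_dist _ _) _.
rewrite transition_dist_state_dist; apply: le_trans (sum_dist_le_tv _ _) _.
by rewrite ler_wpM2l // (le_trans _ tv_c) // tv_le_max_tv.
Qed.

Lemma state_dist_le_max_tv k s a s' : 0 < pi s a * P a s s' ->
  \sum_y `|kpow (state_chain pi P) k s' y - mu y|
  <= 2 * max_tv (@transition_chain R S A pi P) (transition_distr mu) k.+1.
Proof.
rewrite -step_weight_gt0 => sX; pose x : X := exist _ (s, a, s') sX.
apply: le_trans (_ : 2 * tv_dist (kpow (@transition_chain R S A pi P) k.+1 x)
                         (transition_distr mu) <= _).
  by rewrite (le_trans _ (sum_dist_le_tv _ _)) // transition_dist_state_dist.
by apply: ler_wpM2l => //; exact: tv_le_max_tv.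
Qed.

(* At time 0 the law of X_k is a point mass, so mixing time 0 at a level below
   1/2 forces every transition to have stationary mass above 1/2. *)
Lemma single_transition delta : stationary (state_chain pi P) mu ->
  max_tv (@transition_chain R S A pi P) (transition_distr mu) 0 <= delta ->
  delta < 1 / 2 -> forall x y : X, x = y.
Proof.
move=> [[mu0 mu1] _] tv_delta delta2.
have massE (y : X) : transition_distr mu y = mu (val y).1.1 * weight y.
  by case: y => -[[s a] s1] y_pos; rewrite /transition_distr /= mulrA.
have mass0 (y : X) : 0 <= transition_distr mu y.
  by rewrite massE mulr_ge0 // step_weight_ge0.
have mass1 : \sum_(y : X) transition_distr mu y = 1.
  rewrite -mu1 -[RHS](eq_bigr _
    (fun s _ => step_mean_cst pi_distr P_stochastic s (mu s))).
  by rewrite -sum_transition_space; apply: eq_bigr => y _; rewrite massE mulrC.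
have mass_gt (x : X) : 1 / 2 < transition_distr mu x.
  have : `|1 - transition_distr mu x| <= delta.
    apply: le_trans tv_delta; apply: le_trans (tv_le_max_tv _ _ _ x).
    apply: le_trans (fmax_ge _ [set x]%SET).
    by rewrite !big_set1 /= eqxx.
  by rewrite ler_norml => /andP[]; lra.
move=> x y; apply/eqP/negPn/negP => xy.
have : transition_distr mu x + transition_distr mu y <= 1.
  rewrite -mass1 (bigD1 x) //= lerD2l (bigD1 y) 1?eq_sym //= lerDl.
  exact: sumr_ge0.
by have := mass_gt x; have := mass_gt y; lra.
Qed.

End TransitionChain.

(** * Assembling the two finite-time bounds *)

Lemma distr_inhabited (R : realType) (T : finType) (mu : T -> R) :
  is_distr mu -> exists x, 0 < mu x.
Proof.
move=> [mu0 mu1]; apply: contrapT => /forallNP no_pos.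
have := oner_neq0 R; rewrite -mu1 big1 ?eqxx // => x _.
by apply/le_anti; rewrite mu0 andbT leNgt; apply/negP.
Qed.

(* The premise [t = 0 -> alpha < 1/2] of the first part only matters when the
   mixing time t of {X_k} at level alpha vanishes: for t >= 1 it holds
   trivially.  Without it that part fails: take one state, two equiprobable
   actions with rewards 0 and 1 and the same scalar feature, and
   1/2 <= alpha < 1; then t = 0 and the bound tends to 0 with k, while the
   mean square error does not. *)
Theorem theorem3p1 (R : realType) (S A : finType) (d : nat)
    (P : A -> S -> S -> R) (rew : S -> A -> R) (rmax gamma : R)
    (phi : d.-tuple {ffun S * A -> R^o}) (pi : S -> A -> R)
    (mu_S : S -> R) (C' rho' : R) (theta_star : 'cV[R]_d) (kappa : R)
    (disp : measure_display) (Omega : measurableType disp)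
    (Pr : probability Omega R) (St : nat -> Omega -> S) (Ac : nat -> Omega -> A)
    (theta0 : 'cV[R]_d)
    (hP : forall a, stochastic (P a))
    (hrew : forall s a, 0 <= rew s a <= rmax)
    (hgamma : 0 < gamma < 1)
    (hd : (0 < d)%N)
    (hfree : free phi)
    (hphi : forall s a, l2norm (feature phi s a) <= 1)
    (hpi : forall s, is_distr (pi s))
    (hQ1 : assumption_Q1 pi P mu_S C' rho')
    (hQ2 : assumption_Q2 phi rew gamma pi P mu_S theta_star kappa)
    (htraj : is_trajectory Pr pi P St Ac) :
  let theta (step : nat -> R) (k : nat) (w : Omega) : 'cV[R]_d :=
    q_iter phi rew gamma theta0 step (fun i => St i w) (fun i => Ac i w) k in
  let M := 1 + gamma + rmax in
  let eta1 := (l2norm theta0 + l2norm (theta0 - theta_star) + 1) ^+ 2 in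
  let eta2 := 130 * M ^+ 2 * (l2norm theta_star + 1) ^+ 2 in
  let M1 := ln (C' / rho') / ln (1 / rho') in
  (forall alpha : R,
     let t := mixing_time (@transition_chain R S A pi P)
                (transition_distr mu_S) alpha in
     0 < alpha < 1 ->
     alpha * t%:R <= kappa / (260 * M ^+ 2) ->
     (t = 0%N -> alpha < 1 / 2) ->
     forall k : nat, (t <= k)%N ->
       ('E_Pr[fun w => (l2norm (theta (fun=> alpha) k w - theta_star) ^+ 2)%R]
        <= (eta1 * (1 - kappa * alpha / 2) ^+ (k - t)
            + 2 * eta2 * alpha * t%:R / kappa)%:E)%E)
  /\
  (forall alpha : R, 2 / kappa < alpha ->
     exists hbar : R, 0 < hbar /\
       forall h : R, hbar <= h ->
         exists K' : nat, (0 < K')%N /\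
           forall k : nat, (K' <= k)%N ->
             ('E_Pr[fun w => (l2norm (theta (fun j => alpha / (j%:R + h)) k w
                                      - theta_star) ^+ 2)%R]
              <= (eta1 * ((K'%:R + h) / (k%:R + h)) `^ (kappa * alpha / 2)
                  + 16 * expR 1 * eta2 * alpha ^+ 2 * M1 / (kappa * alpha - 2)
                    * ((ln ((k%:R + h) / alpha) + 1) / (k%:R + h)))%:E)%E).
Proof.
move=> theta M eta1 eta2 M1.
have [pi_gt0 _ mu_st [C'1 rho'01] mixS] := hQ1.
have [_ kappa0 _] := hQ2.
have [s0 _] := distr_inhabited mu_st.1; have [a0 _] := distr_inhabited (hpi s0).
pose mu0 s : R := fine (Pr (St 0%N @^-1` [set s])).
have mu0_distr : is_distr mu0 := initial_law_distr htraj.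
pose iter step k (h : traj S A k) := traj_iter phi rew gamma theta0 step h.
have E_eq step k :
    ('E_Pr[fun w => (l2norm (theta step k w - theta_star) ^+ 2)%R]
     = (traj_mean pi P mu0 (fun h : traj S A k =>
          l2norm (iter step k h - theta_star) ^+ 2))%:E)%E.
  rewrite -(expectation_traj htraj a0) => [|h]; last exact: sqr_ge0.
  by congr expectation; apply/funext => w; rewrite /theta q_iter_traj.
have kappa1 : kappa <= 1 := kappa_le1 a0 hphi hpi mu_st hQ2 hd.
have C'0 : 0 <= C' by lra.
have rho'0 : 0 <= rho' by case/andP: rho'01 => /ltW.
have Crho0 k : 0 <= C' * rho' ^+ k by rewrite mulr_ge0 // exprn_ge0.
have M_ge1' : 1 <= M := M_ge1 a0 s0 hrew hgamma.
have M0 : 0 < M by lra.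
split=> [alpha t alpha01 at_le t0 k tk|alpha alpha_gt].
  rewrite E_eq lee_fin; have [alpha0 alpha1] := andP alpha01.
  have : max_tv (@transition_chain R S A pi P) (transition_distr mu_S) t
      <= alpha.
    apply: mixing_time_le.
    have [k' k'_le] := @geometric_small _ (2 * C') _ _ rho'01 alpha0.
    exists k'.+1; apply: le_trans k'_le; rewrite -mulrA.
    exact: max_tv_transition_le.
  move: at_le t0 tk; case: t => [|t] at_le t0 tk tv_t.
    have alpha2 := t0 erefl.
    have same := single_transition hpi hP mu_st tv_t alpha2.
    (* Since [pi] is positive, every pair [(s, a)] begins some admissible transition; as there is
       only one transition, all pairs coincide. *)
    have same_sa s a : s = s0 /\ a = a0.
      have [s' s'0] := distr_inhabited (hP a s).
      have [s1 s10] := distr_inhabited (hP a0 s0).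
      have x1 : (0 < pi s a) && (0 < P a s s') by rewrite pi_gt0.
      have x2 : (0 < pi s0 a0) && (0 < P a0 s0 s1) by rewrite pi_gt0.
      have := congr1 val
          (same (exist _ (s, a, s') x1) (exist _ (s0, a0, s1) x2)).
      by case=> -> ->.
    rewrite subn0 mulr0 mul0r addr0.
    have q0 : 0 <= (1 - kappa * alpha / 2) ^+ k.
      by rewrite exprn_ge0 //; have := ler_wpM2r (ltW alpha0) kappa1; lra.
    rewrite -(traj_mean_cst hpi hP mu0_distr k (eta1 * _)).
    apply: traj_mean_le => // h.
    apply: le_trans
      (single_transition_contraction (a0 := a0) (s0 := s0) hP hgamma hphi hpi
        theta0 mu_st hQ2 h _ _ _ kappa1) _.
    - by move=> s; have [] := same_sa s a0.
    - by move=> a; have [] := same_sa s0 a.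
    - by rewrite !ltW.
    rewrite mulrC ler_wpM2r // /eta1 lerXn2r ?nnegrE ?addr_ge0 ?l2norm_ge0 //.
    by have := l2norm_ge0 theta0; lra.
  have [n ->] : exists n, k = (t.+1 + n)%N by exists (k - t.+1)%N;
      rewrite subnKC.
  rewrite addKn.
  apply: (const_step_bound a0 s0 hP hrew hgamma hphi hpi _ mu_st hQ2 mu0_distr)
    => //.
  - by rewrite ltW.
  - rewrite mulrAC -ler_pdivlMr ?exprn_gt0 //; apply: le_trans at_le _.
    by rewrite invfM mulrA.
  - move=> s a s' sas';
      apply: le_trans (state_dist_le_max_tv mu_S hpi hP t sas') _.
    by rewrite ler_wpM2l.
have alpha0 : 0 < alpha by apply: lt_trans alpha_gt; rewrite divr_gt0.
have ka2 : 2 < kappa * alpha by rewrite mulrC -ltr_pdivrMr.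
(* [alpha <= h] keeps all steps at most 1, and [1 <= h] makes every denominator positive. *)
exists (Num.max alpha 1); split; first by rewrite lt_max ltr01 orbT.
move=> h; rewrite ge_max => /andP[alpha_h h1].
have h0 : 0 < h by lra.
have n0 k : 0 < k%:R + h by rewrite ltr_wpDl.
(* The factor 2 converts total variation to the l1 distance required by [poisson_kernel]. *)
have [k1 k1_le] : exists k, 2 * C' * rho' ^+ k <= 1 / 2.
  by apply: geometric_small; last lra.
have mix_half x : \sum_y `|kpow (state_chain pi P) k1 x y - mu_S y| <= 1 / 2.
  apply: le_trans (sum_dist_le_tv _ _) _; apply: le_trans k1_le.
  rewrite -mulrA; apply: ler_wpM2l => //.
  by apply: le_trans (mixS k1); exact: tv_le_max_tv.
have [Z poisson] :=
    poisson_kernel (state_chain_stochastic hpi hP) mu_st mix_half.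
have [C C0 correctable] :=
  correctable_recursion a0 s0 hP hrew hgamma hphi hpi theta0 mu_st hQ2 mu0_distr
    poisson.
have [] := correctable (fun j => alpha / (j%:R + h)).
  move=> k; apply/andP; split; first by rewrite divr_ge0 // ltW.
  by rewrite ler_pdivrMr // mul1r; apply: le_trans alpha_h _; rewrite lerDr.
move=> D D_rec.
pose step (j : nat) := alpha / (j%:R + h).
pose x k := traj_mean pi P mu0 (fun g : traj S A k =>
  l2norm (iter step k g - theta_star) ^+ 2).
have x0 k : 0 <= x k by apply: traj_mean_ge0 => // g; exact: sqr_ge0.
have D_le k : `|D k| <= C * (1 + x k) by have [] := D_rec k.
have x_le k : x k.+1 <= C * (1 + x k) by have [] := D_rec k.
have x_rec k :
    x k.+1 <= (1 - kappa * step k) * x k + 2 * step k * (D k - D k.+1)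
    + C * step k ^+ 2 * (1 + x k) by have [] := D_rec k.
have [G [N rate]] :=
    corrected_drift_rate C0 alpha0 kappa0 ka2 h0 x0 D_le x_le x_rec.
have M1_gt0 : 0 < M1.
  have rho'p : 0 < rho' by case/andP: rho'01.
  have rho'1 : rho' < 1 by case/andP: rho'01.
  rewrite divr_gt0 // ln_gt0 // ltr_pdivlMr // mul1r //.
  exact: lt_le_trans C'1.
have eta2_gt0 : 0 < eta2.
  apply: mulr_gt0; first by apply: mulr_gt0 => //; exact: exprn_gt0.
  by apply: exprn_gt0; rewrite ltr_wpDl ?l2norm_ge0.
set c := 16 * expR 1 * eta2 * alpha ^+ 2 * M1 / (kappa * alpha - 2).
have c0 : 0 < c.
  apply: divr_gt0; last by rewrite subr_gt0.
  apply: mulr_gt0 => //; apply: mulr_gt0; last exact: exprn_gt0.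
  by apply: mulr_gt0 => //; apply: mulr_gt0 => //; exact: expR_gt0.
(* Beyond [n1] the logarithm exceeds [G / c], so the logarithmic term alone dominates [G / (k + h)];
   of the [eta1] term only the sign is used. *)
pose n1 := Num.bound (alpha * expR (G / c)).
exists (N + n1).+1; split=> // k k_ge.
rewrite E_eq lee_fin -[leLHS]add0r; apply: lerD.
  by rewrite mulr_ge0 ?powR_ge0 // sqr_ge0.
have Nk : (N <= k)%N by apply: leq_trans k_ge; rewrite leqW // leq_addr.
apply: le_trans (rate k Nk) _; rewrite mulrA ler_pM2r ?invr_gt0 //.
have log_ge : G / c <= ln ((k%:R + h) / alpha).
  rewrite -ler_expR lnK ?posrE ?divr_gt0 // ler_pdivlMr // mulrC.
  have n1_gt : alpha * expR (G / c) < n1%:R.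
    by apply: archi_boundP; rewrite mulr_ge0 ?expR_ge0 // ltW.
  apply: le_trans (ltW n1_gt) _; rewrite -[leLHS]addr0.
  apply: lerD (ltW h0); rewrite ler_nat.
  by apply: leq_trans k_ge; rewrite leqW // leq_addl.
rewrite -ler_pdivrMl // mulrC; lra.
Qed.
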